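(* Let $1\le p<\infty$ and let $\|\cdot\|_{p,\vec\mu}$ be a discrete Sobolev $p$-norm such that $\Delta=\operatorname{supp}\mu$ is a bounded real interval and $\mu\in\mathbf{Reg}$. Let $\{P_n\}$ be a sequence of polynomials where, for each $n$, $P_n$ is a monic minimal polynomial of degree $n$ with respect to $\|\cdot\|_{p,\vec\mu}$. Then for every integer $j\ge0$ $$\lim_{n\to\infty}\left\|P_n^{(j)}\right\|_\Delta^{1/n}=\operatorname{cap}(\Delta),$$ and $$\vartheta\!\left(P_n^{(j)}\right)\longrightarrow\omega_\Delta\quad(n\to\infty)\quad\text{in the weak topology of measures.}$$
   Context: Let $\mathbb{P}$ denote the space of all polynomials. Discrete Sobolev $p$-norm: let $\mu$ be a finite positive Borel measure with $\operatorname{supp}\mu\subset\mathbb{R}$ infinite and $\mathbb{P}\subset L^1(\mu)$; let $\Delta$ be the convex hull of $\operatorname{supp}\mu$; let $c_1,\dots,c_N\in\mathbb{R}$ be distinct points, $m_1,\dots,m_N$ nonnegative integers, and $A_{j,k}\ge0$ ($1\le j\le N$, $0\le k\le m_j$) with $A_{j,m_j}>0$ for every $j$. Then for $f\in\mathbb{P}$ $$\|f\|_{p,\vec\mu}=\left(\int_\Delta|f|^p\,d\mu+\sum_{j=1}^N\sum_{k=0}^{m_j}A_{j,k}|f^{(k)}(c_j)|^p\right)^{1/p}.$$ A monic minimal polynomial of degree $n$ is a monic polynomial $P_n$ of degree $n$ with $\|P_n\|_{p,\vec\mu}\le\|Q\|_{p,\vec\mu}$ for every monic polynomial $Q$ of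 degree $n$. $\|\cdot\|_\Delta$ is the supremum norm on $\Delta$ and $\|q\|_{p,\mu}=\left(\int|q|^p\,d\mu\right)^{1/p}$. The condition $\mu\in\mathbf{Reg}$ means that $$\lim_{n\to\infty}\left(\frac{\|q_n\|_\Delta}{\|q_n\|_{p,\mu}}\right)^{1/n}=1$$ for every sequence of polynomials $\{q_n\}$ with $\deg q_n\le n$ and $q_n\not\equiv0$. For a compact set $E\subset\mathbb{C}$, $\operatorname{cap}(E)$ is its logarithmic capacity and $\omega_E$ its equilibrium measure. For a polynomial $q$ of exact degree $d\ge1$ with zeros $z_1,\dots,z_d$ (repeated according to multiplicity), $\vartheta(q)=\frac1d\sum_{i=1}^d\delta_{z_i}$ is the normalized zero counting measure. Weak convergence $\nu_n\to\nu$ means $\int f\,d\nu_n\to\int f\,d\nu$ for every continuous compactly supported $f:\mathbb{C}\to\mathbb{R}$. *)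

(* Defs.v *)
From HB Require Import structures.
From mathcomp Require Import all_boot all_order all_algebra.
From mathcomp Require Import all_classical all_reals all_analysis.
From mathcomp Require Import complex.
Set Implicit Arguments.
Unset Strict Implicit.
Unset Printing Implicit Defensive.
Import Order.TTheory GRing.Theory Num.Theory.
Import numFieldNormedType.Exports.
Local Open Scope classical_set_scope.
Local Open Scope complex_scope.
Local Open Scope ring_scope.

(* The modulus of a complex number, as an element of R (the norm `|z| of
   MathComp lives in R[i]). *)
Definition cabs (R : realType) (z : R[i]) : R := ComplexField.Normc.normc z.

(* MathComp-Analysis provides the Borel sigma-algebra, the topology and the
   product measures on R * R but not on R[i]; measures on the complex plane are
   therefore measures on R * R, via z |-> (Re z, Im z).  *)
Definition plane_of (R : realType) (z : R[i]) : R * R :=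
  (complex.Re z, complex.Im z).

Definition complex_of_plane (R : realType) (z : R * R) : R[i] :=
  z.1 +i* z.2.

Definition real_in_plane (R : realType) (D : set R) : set (R * R) :=
  [set z | D z.1 /\ z.2 = 0].

Section Sobolev.
Context (R : realType).

Definition msupport (mu : {measure set R -> \bar R}) : set R :=
  [set x | forall U : set R, open U -> U x -> (0 < mu U)%E].

(* In R, the convex hull of a set is the smallest interval containing it. *)
Definition hull (mu : {measure set R -> \bar R}) : set R :=
  [set` Rhull (msupport mu)].

(* Meaningful when D is nonempty and bounded. *)
Definition sup_norm (D : set R) (q : {poly R[i]}) : R :=
  sup [set cabs q.[x%:C] | x in D].

Definition p_norm (p : R) (mu : {measure set R -> \bar R})
    (q : {poly R[i]}) : R :=
  (\int[mu]_x (cabs q.[x%:C] `^ p)) `^ p^-1.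

Definition sobolev_norm (p : R) (mu : {measure set R -> \bar R}) (N : nat)
    (c : 'I_N -> R) (m : 'I_N -> nat) (A : 'I_N -> nat -> R)
    (q : {poly R[i]}) : R :=
  (\int[mu]_(x in hull mu) (cabs q.[x%:C] `^ p)
   + \sum_(j < N) \sum_(k < (m j).+1)
       A j k * cabs (q^`(k)).[(c j)%:C] `^ p) `^ p^-1.

Definition monic_minimal (nrm : {poly R[i]} -> R) (n : nat)
    (P : {poly R[i]}) : Prop :=
  [/\ P \is monic, size P = n.+1 &
      forall Q : {poly R[i]}, Q \is monic -> size Q = n.+1 -> nrm P <= nrm Q].

Definition Reg (p : R) (mu : {measure set R -> \bar R}) : Prop :=
  forall q : nat -> {poly R[i]},
    (forall n, (size (q n) <= n.+1)%N) -> (forall n, q n != 0) ->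
    (sup_norm (hull mu) (q n) / p_norm p mu (q n)) `^ n%:R^-1
      @[n --> \oo] --> (1 : R).

End Sobolev.

Section Potential.
Context (R : realType).

Definition log_kernel (zw : (R * R) * (R * R)) : \bar R :=
  if zw.1 == zw.2 then +oo%E
  else (- ln (cabs (complex_of_plane zw.1 - complex_of_plane zw.2)))%:E.

Definition log_energy (nu : probability (R * R)%type R) : \bar R :=
  (\int[(nu \x nu)%E]_zw log_kernel zw)%E.

(* The probability measures carried by E; for compact E the kernel is bounded
   below on E * E, so that the energy of each of them is a well-defined element
   of ]-oo, +oo]. *)
Definition prob_on (E : set (R * R)) : set (probability (R * R)%type R) :=
  [set nu | nu E = 1%E].

(* cap(E) = exp(- inf of the energies); it is 0 if all the energies are +oo. *)
Definition cap (E : set (R * R)) : R :=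
  fine (expeR (- ereal_inf (log_energy @` prob_on E))%E).

Definition is_equilibrium (E : set (R * R))
    (nu : probability (R * R)%type R) : Prop :=
  prob_on E nu /\ forall nu', prob_on E nu' -> (log_energy nu <= log_energy nu')%E.

(* The energy minimizer is unique when E is compact with cap E > 0; the Dirac
   mass is only the default value if there is no minimizer. *)
Definition equilibrium_measure (E : set (R * R)) :
    probability (R * R)%type R :=
  xget (\d_((0, 0) : R * R) : probability (R * R)%type R)
    [set nu | is_equilibrium E nu].

(* The zeros of q, repeated according to multiplicity (for q != 0). *)
Definition zeros (q : {poly R[i]}) : seq R[i] :=
  sval (closed_field_poly_normal q).

(* The zero measure if q is constant. *)
Definition zero_counting (q : {poly R[i]}) : {measure set (R * R) -> \bar R} :=
  let d := (size q).-1 in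
  mscale (d%:R^-1)%:nng
    (msum (fun i => \d_(plane_of (nth 0 (zeros q) i))) d).

Definition weak_cvg (nu_ : nat -> {measure set (R * R) -> \bar R})
    (nu : {measure set (R * R) -> \bar R}) : Prop :=
  forall f : R * R -> R, continuous f ->
    compact (closure [set z | f z != 0]) ->
    \int[nu_ n]_z f z @[n --> \oo] --> \int[nu]_z f z.

End Potential.

(* Main.v *)
(* Write Delta = [m - h, m + h] and J w = m + (h/2)(w + 1/w), so that the unit
   circle covers Delta, cap Delta = h/2, and every zero of a polynomial is J u
   for some 0 < |u| <= 1.

   Limit of the norms.  Comparing P_n with prod_j (X - c_j)^(m_j+1) times a
   monic Chebyshev polynomial, for which the discrete part of the norm
   vanishes, bounds ||P_n||_{p,mu} by K (h/2)^n; regularity turns this into a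
   bound for ||P_n||_Delta, and a Markov-type inequality (Cauchy estimates on
   small discs together with the growth of a polynomial off Delta) into one for
   the derivatives.  Conversely a monic q of degree d has ||q||_Delta >= (h/2)^d,
   because w^d q(J w) is a polynomial in w with constant term (h/2)^d.

   Zeros.  If q = prod (X - J u_i) is monic with ||q||_Delta <= M (h/2)^d, then
   G w = prod (1 - u_i w)(1 - conj(u_i) w) is bounded by M prod |u_i| on the unit
   circle and has no zero inside.  Jensen's inequality gives
   sum ln (1/|u_i|) <= ln M, and the Fourier coefficients of ln |G| give
   |sum Re u_i^k| <= k ln ((2d+1) M).  When ln M = o(d) this determines the limit
   of (1/d) sum f(z_i) for every test function f, through a uniform
   approximation of f on Delta by Chebyshev polynomials.

   Equilibrium measure.  The expansion
   - ln |x - y| = - ln (h/2) + sum_k (2/k) T_k(x) T_k(y) shows that the energy of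
   nu is at least - ln (h/2) + (2/k) (int T_k dnu)^2 for every k >= 1, while the
   arcsine distribution has energy - ln (h/2); hence cap Delta = h/2, and every
   minimizer has the Chebyshev moments found for the zeros.  All series are
   replaced by finite sums with explicit remainders, and contour integrals by
   averages over roots of unity. *)

Require Import Defs.
From HB Require Import structures.
From mathcomp Require Import all_boot all_order all_algebra.
From mathcomp Require Import all_classical all_reals all_analysis.
From mathcomp Require Import complex.
From mathcomp Require Import measurable_realfun cyclic separable cyclotomic.
From mathcomp Require Import zify ring lra.
Import Order.TTheory GRing.Theory Num.Theory.
Import numFieldNormedType.Exports.
Local Open Scope classical_set_scope.
Local Open Scope complex_scope.
Local Open Scope ring_scope.

Set Implicit Arguments.
Unset Strict Implicit.
Unset Printing Implicit Defensive.

(** * Complex modulus and averages over roots of unity *)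

Section Modulus.
Context (R : realType).
Implicit Types (z w : R[i]) (x : R).

Lemma normr_cabs z : `|z| = (cabs z)%:C.
Proof. by []. Qed.

Lemma cabs_ge0 z : 0 <= cabs z.
Proof. by rewrite -lecR -normr_cabs normr_ge0. Qed.

Lemma cabsM z w : cabs (z * w) = cabs z * cabs w.
Proof. by apply: ComplexField.Normc.normcM. Qed.

Lemma cabsV z : cabs z^-1 = (cabs z)^-1.
Proof. by apply: ComplexField.Normc.normcV. Qed.

Lemma cabs0 : cabs (0 : R[i]) = 0.
Proof. by apply: ComplexField.Normc.normc0. Qed.

Lemma cabs1 : cabs (1 : R[i]) = 1.
Proof. by apply: ComplexField.Normc.normc1. Qed.

Lemma cabs_eq0 z : (cabs z == 0) = (z == 0).
Proof.
apply/eqP/eqP => [/ComplexField.Normc.eq0_normc//|->]; exact: cabs0.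
Qed.

Lemma cabs_gt0 z : (0 < cabs z) = (z != 0).
Proof. by rewrite lt_def cabs_eq0 cabs_ge0 andbT. Qed.

Lemma cabsD z w : cabs (z + w) <= cabs z + cabs w.
Proof. exact: le_normcD. Qed.

Lemma cabsN z : cabs (- z) = cabs z.
Proof. exact: normcN. Qed.

Lemma cabsB z w : cabs (z - w) = cabs (w - z).
Proof. by rewrite -cabsN opprB. Qed.

Lemma cabs_sub z w : cabs z - cabs w <= cabs (z - w).
Proof. by rewrite lerBlDr; apply: le_trans (cabsD _ _); rewrite subrK. Qed.

Lemma cabsX z n : cabs (z ^+ n) = cabs z ^+ n.
Proof. by elim: n => [|n IH]; rewrite ?expr0 ?cabs1// !exprS cabsM IH. Qed.

Lemma cabs_real x : cabs x%:C = `|x|.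
Proof. by rewrite /cabs /= expr0n addr0 sqrtr_sqr. Qed.

Lemma cabs_nat n : cabs (n%:R : R[i]) = n%:R.
Proof. by rewrite -(rmorph_nat (real_complex R)) cabs_real normr_nat. Qed.

Lemma cabs_prod (I : Type) (r : seq I) (F : I -> R[i]) :
  cabs (\prod_(i <- r) F i) = \prod_(i <- r) cabs (F i).
Proof. by apply: (big_morph _ cabsM cabs1). Qed.

Lemma cabs_sum (I : Type) (r : seq I) (P : pred I) (F : I -> R[i]) :
  cabs (\sum_(i <- r | P i) F i) <= \sum_(i <- r | P i) cabs (F i).
Proof.
elim/big_rec2: _ => [|i y z _ IH]; first by rewrite cabs0.
by apply: le_trans (cabsD _ _) _; rewrite lerD2l.
Qed.

Lemma cabs_sqr z : cabs z ^+ 2 = complex.Re z ^+ 2 + complex.Im z ^+ 2.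
Proof. by case: z => a b; rewrite /cabs /= sqr_sqrtr// addr_ge0 ?sqr_ge0. Qed.

Lemma cabs_conj z : cabs z^*%C = cabs z.
Proof. by case: z => a b; rewrite /cabs /= sqrrN. Qed.

Lemma normr_Re z : `|complex.Re z| <= cabs z.
Proof.
rewrite -(ler_pXn2r (n := 2)) ?nnegrE ?cabs_ge0// cabs_sqr real_normK ?num_real//.
by rewrite lerDl sqr_ge0.
Qed.

Lemma normr_Im z : `|complex.Im z| <= cabs z.
Proof.
rewrite -(ler_pXn2r (n := 2)) ?nnegrE ?cabs_ge0// cabs_sqr real_normK ?num_real//.
by rewrite lerDr sqr_ge0.
Qed.

Lemma Re_sum (I : Type) (r : seq I) (P : pred I) (F : I -> R[i]) :
  complex.Re (\sum_(i <- r | P i) F i) = \sum_(i <- r | P i) complex.Re (F i).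
Proof. by apply: (big_morph (@complex.Re R)) => // -[? ?] [? ?]. Qed.

Lemma ReD z w : complex.Re (z + w) = complex.Re z + complex.Re w.
Proof. by case: z w => ? ? []. Qed.

Lemma ReN z : complex.Re (- z) = - complex.Re z.
Proof. by case: z. Qed.

Lemma ReZ x z : complex.Re (x%:C * z) = x * complex.Re z.
Proof. by case: z => a b /=; rewrite mul0r subr0. Qed.

Lemma complexRe_conj z : complex.Re z^*%C = complex.Re z.
Proof. by case: z. Qed.

Lemma mul_conj z : z * z^*%C = (cabs z ^+ 2)%:C.
Proof. by case: z => a b; rewrite cabs_sqr /=; simpc; congr (_ +i* _); ring. Qed.

Lemma unit_conj z : cabs z = 1 -> z^*%C = z^-1.
Proof.
move=> z1; have z0 : z != 0 by rewrite -cabs_eq0 z1 oner_eq0.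
by apply: (mulfI z0); rewrite mul_conj z1 expr1n mulfV.
Qed.

(** In characteristic 0 the polynomial X^N - 1 is separable, so it has N distinct roots, and one of
    them must be primitive. *)
Lemma unit_root_exists (N : nat) : (0 < N)%N ->
  exists z : R[i], N.-primitive_root z.
Proof.
move=> N0.
pose p : {poly R[i]} := 'X^N - 1%:P.
have [r Dp] := closed_field_poly_normal p.
have p0 : p != 0 by rewrite monic_neq0 ?monicXnsubC.
have lp : lead_coef p = 1 by apply/monicP; rewrite monicXnsubC.
rewrite lp scale1r in Dp.
have sr : size r = N.
  have := congr1 (fun q : {poly _} => size q) Dp.
  by rewrite size_prod_XsubC size_XnsubC// => -[].
have rts : all N.-unity_root r.
  by apply/allP => z; rewrite unity_rootE /root => zr; rewrite -subr_eq0;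
     have := root_prod_XsubC r z; rewrite -Dp zr /root !hornerE.
have ur : uniq r.
  by rewrite -separable_prod_XsubC -Dp /p polyC1 separable_Xn_sub_1 // pnatr_eq0 -lt0n.
have /hasP[z _ hz] := has_prim_root N0 rts ur (eq_leq (esym sr)).
by exists z.
Qed.

Lemma prim_root_cabs (N : nat) z : N.-primitive_root z -> cabs z = 1.
Proof.
move=> hz; have N0 := prim_order_gt0 hz.
apply/eqP; rewrite -(@pexpr_eq1 _ _ N)// ?cabs_ge0//.
by rewrite -cabsX (prim_expr_order hz) cabs1.
Qed.

Lemma sum_prim_root (N : nat) z (k : nat) : N.-primitive_root z ->
  \sum_(l < N) (z ^+ l) ^+ k = if (N %| k)%N then N%:R else 0.
Proof.
move=> hz; rewrite (prim_order_dvd hz).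
under eq_bigr do rewrite exprAC.
case: eqP => [->|/eqP z1].
  by under eq_bigr do rewrite expr1n; rewrite sumr_const card_ord.
have z1' : z ^+ k - 1 != 0 by rewrite subr_eq0.
by apply: (mulfI z1'); rewrite -subrX1 exprAC (prim_expr_order hz) expr1n subrr mulr0.
Qed.

(** Cauchy's estimate without an integral. With N = [size p], the average of p(z) z^(N - k) over the
    N-th roots of unity is exactly the k-th coefficient, because k is the only index below N with N
    dividing i + (N - k). *)
Lemma coef_bound (p : {poly R[i]}) (M : R) (k : nat) :
  (forall z, cabs z = 1 -> cabs p.[z] <= M) -> cabs p`_k <= M.
Proof.
move=> pM.
have M0 : 0 <= M by apply: le_trans (pM 1 cabs1); exact: cabs_ge0.
have [kp|] := ltnP k (size p); last by move=> /leq_sizeP/(_ _ (leqnn k)) ->; rewrite cabs0.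
have N0 : (0 < size p)%N by apply: leq_ltn_trans kp.
have [z hz] := unit_root_exists N0.
set N := size p in N0 kp hz.
have E : \sum_(l < N) p.[z ^+ l] * (z ^+ l) ^+ (N - k) = N%:R * p`_k.
  under eq_bigr => l _ do rewrite horner_coef mulr_suml.
  rewrite exchange_big /=.
  under eq_bigr => i _ do (under eq_bigr => l _ do rewrite -mulrA -exprD;
     rewrite -mulr_sumr sum_prim_root//).
  rewrite (bigD1 (Ordinal kp))//= big1 ?addr0.
    by rewrite subnKC ?dvdnn 1?mulrC // ltnW.
  move=> i ik; case: ifP => [|_]; last by rewrite mulr0.
  case/dvdnP => q; move: ik (ltn_ord i); rewrite -val_eqE /= => ik iN E.
  have : (0 < i + (N - k) < 2 * N)%N by lia.
  rewrite E muln_gt0 ltn_mul2r => /andP[/andP[q0 _] /andP[_ q2]].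
  exfalso; have q1 : q = 1%N by lia.
  have ik2 : nat_of_ord i = k by apply: (@addIn (N - k)%N); rewrite E q1 mul1n subnKC// ltnW.
  by case/eqP: ik; rewrite -ik2.
have N0' : 0 < N%:R :> R by rewrite ltr0n.
rewrite -(ler_pM2l N0') -[X in X * _ <= _]cabs_nat -cabsM -E.
apply: le_trans (cabs_sum _ _ _) _.
rewrite mulr_natl -[X in _ *+ X]card_ord -sumr_const; apply: ler_sum => l _.
rewrite cabsM !cabsX (prim_root_cabs hz) !expr1n mulr1.
by apply: pM; rewrite cabsX (prim_root_cabs hz) expr1n.
Qed.

End Modulus.

(** * Truncated power series of ln |1 - z| *)

Section LogTruncation.
Context (R : realType).
Implicit Types z : R[i].

Lemma cabs_1Breal_sqr (t : R) z :
  cabs (1 - t%:C * z) ^+ 2 =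
  (1 - t * complex.Re z) ^+ 2 + (t * complex.Im z) ^+ 2.
Proof. by rewrite cabs_sqr; case: z => a b /=; ring. Qed.

Lemma cabs_1B_gt0 z : cabs z < 1 -> 0 < cabs (1 - z).
Proof.
move=> z1; apply: lt_le_trans (cabs_sub 1 z).
by rewrite cabs1 subr_gt0.
Qed.

Lemma ln_cabs z : ln (cabs z) = 2^-1 * ln (cabs z ^+ 2).
Proof.
have [->|z0] := eqVneq z 0; first by rewrite cabs0 expr0n /= ln0// mulr0.
by rewrite lnXn ?cabs_gt0// -[ln _ *+ 2]mulr_natl mulKf ?pnatr_eq0.
Qed.

(* Mean value theorem for t |-> ln |1 - t z| + sum_k t^k Re z^k / k on [0, 1]:
   its derivative is the real part of the tail of a geometric series. *)
Lemma ln_cabs_trunc z (L : nat) : cabs z < 1 ->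
  `|ln (cabs (1 - z)) + \sum_(k < L) complex.Re (z ^+ k.+1) / k.+1%:R|
    <= cabs z ^+ L.+1 / (1 - cabs z).
Proof.
move=> z1.
pose a := complex.Re z; pose b := complex.Im z.
(* |1 - t z|^2 as a real polynomial in t; half of its logarithm is ln |1 - t z|. *)
pose p : {poly R} := 1%:P - (2 * a) *: 'X + (a ^+ 2 + b ^+ 2) *: 'X^2.
pose S : {poly R} :=
  \sum_(k < L) (complex.Re (z ^+ k.+1) / k.+1%:R) *: 'X^(k.+1).
have pE t : p.[t] = cabs (1 - t%:C * z) ^+ 2.
  by rewrite cabs_1Breal_sqr /p !hornerE /= -/a -/b; ring.
have tz (t : R) : 0 <= t <= 1 -> cabs (t%:C * z) <= cabs z.
  move=> /andP[t0 t1]; rewrite cabsM cabs_real ger0_norm//.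
  by rewrite ler_piMl ?cabs_ge0.
have p_gt0 (t : R) : 0 <= t <= 1 -> 0 < p.[t].
  by move=> t01; rewrite pE exprn_gt0// cabs_1B_gt0// (le_lt_trans (tz _ t01)).
pose f (t : R) := 2^-1 * ln p.[t] + S.[t].
pose df (t : R) := 2^-1 * (p.[t]^-1 * p^`().[t]) + S^`().[t].
have fD (t : R) : 0 <= t <= 1 -> is_derive t (1 : R) f (df t).
  move=> t01; have h := is_derive1_ln (p_gt0 _ t01).
  have h2 := is_derive1_comp h (is_derive_poly p t).
  have h3 := is_deriveD (is_deriveZ 2^-1 h2) (is_derive_poly S t).
  exact: h3.
have cf : {within `[0, 1], continuous f}.
  apply: derivable_within_continuous => t; rewrite in_itv/= => /fD [] //.
have [|t] := @MVT R f df 0 1 ltr01 _ cf.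
  by move=> t; rewrite in_itv/= => /andP[t0 t1]; apply: fD; rewrite !ltW.
rewrite in_itv/= => /andP[t0 t1] E.
have t01 : 0 <= t <= 1 by rewrite !ltW.
have f0 : f 0 = 0.
  rewrite /f pE rmorph0 mul0r subr0 cabs1 expr1n ln1 mulr0 add0r.
  rewrite horner_sum big1// => k _.
  by rewrite !hornerE expr0n /= mulr0.
have f1 : f 1 = ln (cabs (1 - z)) + \sum_(k < L) complex.Re (z ^+ k.+1) / k.+1%:R.
  rewrite /f pE rmorph1 mul1r -ln_cabs horner_sum; congr (_ + _); apply: eq_bigr => k _.
  by rewrite !hornerE expr1n mulr1.
rewrite -f1 -[f 1]subr0 -f0 E subr0 mulr1.
have nz : 1 - t%:C * z != 0 by rewrite -cabs_gt0 cabs_1B_gt0// (le_lt_trans (tz _ t01)).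
have -> : df t = - complex.Re (z ^+ L.+1 * t%:C ^+ L / (1 - t%:C * z)).
  have -> : df t = complex.Re (- z / (1 - t%:C * z) + \sum_(k < L) z * (t%:C * z) ^+ k).
    rewrite ReD; congr (_ + _).
      have n0 : (1 - t * a) ^+ 2 + (t * b) ^+ 2 != 0.
        by have := p_gt0 _ t01; rewrite pE cabs_1Breal_sqr => /lt0r_neq0.
      have -> : p^`().[t] = - 2 * a + 2 * (a ^+ 2 + b ^+ 2) * t.
        rewrite /p !(derivD, derivZ, derivXn, derivX, derivC, derivN).
        by rewrite !hornerE /=; ring.
      rewrite pE cabs_1Breal_sqr -/a -/b; move: n0; rewrite /a /b; case: (z) => c d /= n0.
      by rewrite !(mul0r, subr0, addr0, sub0r) sqrrN; field.
    rewrite Re_sum /S raddf_sum horner_sum; apply: eq_bigr => k _ /=.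
    rewrite derivZ derivXn !hornerE /= exprMn mulrCA -exprS -rmorphXn ReZ.
    by rewrite hornerMn hornerXn; field; rewrite nat1r pnatr_eq0.
  rewrite -ReN; congr complex.Re; rewrite -mulr_sumr.
  have -> : \sum_(k < L) (t%:C * z) ^+ k = (1 - (t%:C * z) ^+ L) / (1 - t%:C * z).
    by apply: (mulIf nz); rewrite mulfVK// mulrC -[1 - (_ ^+ L)]opprB subrX1; ring.
  by rewrite exprMn exprS; field.
rewrite normrN (le_trans (normr_Re _))//.
rewrite cabsM cabsV cabsM !cabsX ler_pM ?mulr_ge0 ?invr_ge0 ?exprn_ge0 ?cabs_ge0//.
  rewrite ler_piMr ?exprn_ge0 ?cabs_ge0// cabs_real exprn_ile1// ger0_norm// ltW//.
rewrite lef_pV2 ?posrE ?cabs_gt0 ?subr_gt0//.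
by rewrite (le_trans _ (cabs_sub _ _))// cabs1 lerB// tz.
Qed.
End LogTruncation.

(** * Limits in inequalities and logarithms of products *)

Section LimitHelpers.
Context (R : realType).
Implicit Types a b c r s : R.

(** Removes the remainder of a series truncated at L by letting L tend to infinity. *)
Lemma le_of_geometric a b c r (L0 : nat) : 0 <= r < 1 ->
  (forall L, (L0 <= L)%N -> a <= b + c * r ^+ L) -> a <= b.
Proof.
move=> /andP[r0 r1] H.
apply: (@cvgr_to_ge _ \oo _ _ (fun L => b + c * r ^+ L)).
  rewrite -[X in _ --> X]addr0 -(mulr0 c).
  apply: cvgD; first exact: cvg_cst.
  by apply: cvgM; [exact: cvg_cst|apply: cvg_expr; rewrite ger0_norm].
by exists L0.
Qed.

Lemma le_of_left_power a b (k : nat) :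
  (forall r, 0 < r < 1 -> r ^+ k * a <= b) -> a <= b.
Proof.
move=> H.
apply: (@cvgr_to_le _ (1 : R)^'- _ _ (fun r => r ^+ k * a)); last first.
  near=> r; apply: H; apply/andP; split; near: r.
    exact: nbhs_left_gt.
  exact: nbhs_left_lt.
have -> : nbhs a = nbhs (1 ^+ k * a) by rewrite expr1n mul1r.
apply: cvgM; last exact: cvg_cst.
apply: cvg_at_left_filter.
have cX : continuous (fun x : R => x ^+ k) by exact: exprn_continuous.
exact: cX.
Unshelve. all: by end_near. Qed.

Lemma prodr_seq_gt0 (T : eqType) (s : seq T) (F : T -> R) :
  {in s, forall x, 0 < F x} -> 0 < \prod_(x <- s) F x.
Proof.
move=> F0; rewrite big_seq; elim/big_rec: _ => [|x y xs y0]; first exact: ltr01.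
by rewrite mulr_gt0 ?F0.
Qed.

Lemma ln_prod (T : eqType) (s : seq T) (F : T -> R) :
  {in s, forall x, 0 < F x} ->
  ln (\prod_(x <- s) F x) = \sum_(x <- s) ln (F x).
Proof.
elim: s => [|x s IH] F0; first by rewrite !big_nil ln1.
have F0s : {in s, forall x, 0 < F x} by move=> y ys; apply: F0; rewrite in_cons ys orbT.
rewrite !big_cons lnM ?posrE ?IH//; first by apply: F0; exact: mem_head.
exact: prodr_seq_gt0.
Qed.

End LimitHelpers.

(** * Power sums from a bound on a product in the unit disc *)

Section PowerSums.
Context (R : realType).
Implicit Types (z w u v : R[i]).

Lemma ReM_Re z w :
  complex.Re z * complex.Re w =
  2^-1 * (complex.Re (w * z) + complex.Re (w * z^*%C)).
Proof. by case: z w => a b [c d] /=; field. Qed.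

Lemma Re_sum_prim_root (N : nat) z c (j : nat) : N.-primitive_root z ->
  \sum_(l < N) complex.Re (c * (z ^+ l) ^+ j) =
  if (N %| j)%N then N%:R * complex.Re c else 0.
Proof.
move=> hz; rewrite -Re_sum -mulr_sumr sum_prim_root//; case: ifP => _.
  by rewrite mulrC -(rmorph_nat (real_complex R)) ReZ.
by rewrite mulr0.
Qed.

(** By the product-to-sum formula the exponents j, j + k and j - k occur, the last one written j +
    (N - k). The first two lie strictly between 0 and N, so their sums vanish; the third survives
    only for j = k. *)
Lemma sum_weight_Re (N : nat) z c (s : R) (j k : nat) : N.-primitive_root z ->
  (0 < j)%N -> (0 < k)%N -> (j + k < N)%N ->
  \sum_(l < N) (1 + s * complex.Re ((z ^+ l) ^+ k)) *
     complex.Re (c * (z ^+ l) ^+ j)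
  = if j == k then 2^-1 * s * N%:R * complex.Re c else 0.
Proof.
move=> hz j0 k0 jkN.
have E l : (1 + s * complex.Re ((z ^+ l) ^+ k)) * complex.Re (c * (z ^+ l) ^+ j)
   = complex.Re (c * (z ^+ l) ^+ j) + 2^-1 * s * complex.Re (c * (z ^+ l) ^+ (j + k))
     + 2^-1 * s * complex.Re (c * (z ^+ l) ^+ (j + (N - k))).
  rewrite mulrDl mul1r -mulrA ReM_Re -addrA; congr (_ + _).
  have -> : ((z ^+ l) ^+ k)^*%C = (z ^+ l) ^+ (N - k).
    rewrite unit_conj; last by rewrite !cabsX (prim_root_cabs hz) !expr1n.
    have zu : z ^+ l != 0 by rewrite -cabs_gt0 cabsX (prim_root_cabs hz) expr1n.
    have zuk : (z ^+ l) ^+ k != 0 by rewrite expf_eq0 (negbTE zu) andbF.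
    apply: (mulfI zuk).
    rewrite mulfV -?exprD ?subnKC; [|lia|exact: zuk].
    by rewrite exprAC (prim_expr_order hz) expr1n.
  by rewrite !exprD !mulrA; ring.
under eq_bigr do rewrite E.
rewrite !big_split /= -!mulr_sumr !Re_sum_prim_root//.
have -> : (N %| j)%N = false by apply: gtnNdvd => //; lia.
have -> : (N %| j + k)%N = false by apply: gtnNdvd => //; lia.
rewrite mulr0 addr0 add0r.
have -> : (N %| j + (N - k))%N = (j == k).
  apply/idP/eqP => [|->]; last by rewrite subnKC ?dvdnn//; lia.
  case/dvdnP => q E'.
  have H : (0 < q * N < 2 * N)%N by rewrite -E'; lia.
  move: H; rewrite muln_gt0 ltn_mul2r => /andP[/andP[q0 _] /andP[_ q2]].
  have q1 : q = 1%N by lia.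
  by apply: (@addIn (N - k)%N); rewrite E' q1 mul1n subnKC//; lia.
by case: ifP => _; rewrite ?mulr0// mulrA.
Qed.

(* Averaging [ln |prod (1 - v w)|] over a circle |w| = r against the
   nonnegative weight 1 + s Re w^k isolates the k-th power sum. *)
Lemma power_sum_bound (vs : seq R[i]) (M : R) (k : nat) : (0 < k)%N ->
  {in vs, forall v, cabs v <= 1} ->
  (forall w, cabs w < 1 -> \prod_(v <- vs) cabs (1 - v * w) <= M) ->
  `|\sum_(v <- vs) complex.Re (v ^+ k)| <= 2 * k%:R * ln M.
Proof.
move=> k0 vs1 HM.
have M1 : 1 <= M.
  have := HM 0; rewrite cabs0 ltr01 => /(_ isT); apply: le_trans.
  by rewrite big1_seq// => v _; rewrite mulr0 subr0 cabs1.
(* The two signs give the two sides of the absolute value, and both keep the weight 1 + s Re w^k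
   nonnegative on the unit circle. *)
suff H s : s = 1 \/ s = -1 ->
    - s * (\sum_(v <- vs) complex.Re (v ^+ k)) <= 2 * k%:R * ln M.
  rewrite ler_norml; have h1 := H 1 (or_introl erefl).
  have h2 := H (-1) (or_intror erefl).
  by apply/andP; split; move: h1 h2; rewrite ?opprK ?mulN1r ?mul1r; lra.
move=> s1.
(* On the circle of radius r < 1 the logarithmic series converge geometrically; the factor r^k
   disappears as r tends to 1. *)
apply: (@le_of_left_power _ _ _ k) => r /andP[r0 r1].
set S := \sum_(v <- vs) _.
suff : - (2^-1 * s / k%:R) * r ^+ k * S <= ln M.
  have k0' : 0 < k%:R :> R by rewrite ltr0n.
  have k2 : 0 < 2 * k%:R :> R by rewrite mulr_gt0.
  rewrite -(ler_pM2l k2); apply: le_trans; rewrite le_eqVlt; apply/orP; left; apply/eqP.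
  by field; rewrite lt0r_neq0.
apply: (@le_of_geometric _ _ _ ((size vs)%:R * (r / (1 - r))) r k).
  by rewrite ltW.
move=> L kL.
(* The order L + k + 1 exceeds j + k for every exponent j <= L of the truncated series, so
   [sum_weight_Re] applies to each of its terms. *)
have [z hz] := @unit_root_exists R (L + k).+1 isT.
set N := (L + k).+1 in hz.
have N0 : 0 < N%:R :> R by rewrite ltr0n.
pose W (l : 'I_N) := 1 + s * complex.Re ((z ^+ l) ^+ k).
have zl1 (l : nat) : cabs (z ^+ l) = 1 by rewrite cabsX (prim_root_cabs hz) expr1n.
have W0 l : 0 <= W l.
  have := normr_Re ((z ^+ l) ^+ k); rewrite cabsX zl1 expr1n ler_norml /W => /andP[].
  by case: s1 => ->; lra.
have sumW : \sum_l W l = N%:R.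
  rewrite big_split /= sumr_const card_ord -mulr_sumr.
  have := @Re_sum_prim_root N z 1 k hz.
  under eq_bigr do rewrite mul1r.
  by move=> ->; rewrite gtnNdvd//; [rewrite mulr0 addr0|rewrite /N; lia].
have vr v (l : nat) : v \in vs -> cabs (v * (r%:C * z ^+ l)) <= r.
  move=> /vs1 v1; rewrite !cabsM zl1 mulr1 cabs_real (ger0_norm (ltW r0)).
  by rewrite ler_piMl// ltW.
rewrite -(ler_pM2l N0).
have U : \sum_l W l * \sum_(v <- vs) ln (cabs (1 - v * (r%:C * z ^+ l))) <= N%:R * ln M.
  rewrite -sumW mulr_suml; apply: ler_sum => l _; apply: ler_wpM2l => //.
  have w1 : cabs (r%:C * z ^+ l) < 1 by rewrite cabsM zl1 mulr1 cabs_real (ger0_norm (ltW r0)).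
  have P : {in vs, forall v, 0 < cabs (1 - v * (r%:C * z ^+ l))}.
    by move=> v vvs; apply: cabs_1B_gt0; apply: le_lt_trans r1; apply: vr.
  rewrite -ln_prod// ler_ln ?posrE ?HM//; first exact: prodr_seq_gt0.
  by apply: lt_le_trans M1; exact: ltr01.
pose T v (l : nat) := \sum_(j < L) complex.Re ((v * (r%:C * z ^+ l)) ^+ j.+1) / j.+1%:R.
have Lo : \sum_l W l * \sum_(v <- vs) (- T v l - r ^+ L.+1 / (1 - r)) <= N%:R * ln M.
  apply: le_trans U; apply: ler_sum => l _; apply: ler_wpM2l => //.
  rewrite !big_seq; apply: ler_sum => v vvs.
  have v1 := vr v l vvs.
  have := @ln_cabs_trunc _ _ L (le_lt_trans v1 r1); rewrite -/(T v l) ler_norml => /andP[h _].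
  have h2 : cabs (v * (r%:C * z ^+ l)) ^+ L.+1 / (1 - cabs (v * (r%:C * z ^+ l))) <= r ^+ L.+1 / (1 - r).
    apply: ler_pM; rewrite ?exprn_ge0 ?cabs_ge0 ?invr_ge0 ?subr_ge0//.
    - by rewrite (le_trans v1)// ltW.
    - by rewrite lerXn2r ?nnegrE ?cabs_ge0// ltW.
    - by rewrite lef_pV2 ?posrE ?subr_gt0// ?lerB//; exact: le_lt_trans v1 r1.
  by move: h h2; lra.
(* Orthogonality leaves only the k-th term of the series. *)
have ET v : \sum_l W l * T v l = 2^-1 * s * N%:R * complex.Re ((v * r%:C) ^+ k) / k%:R.
  under eq_bigr => l _ do rewrite mulr_sumr.
  rewrite exchange_big /=.
  have kL' : (k.-1 < L)%N by lia.
  have E (j : 'I_L) : \sum_(i < N) W i * (complex.Re ((v * (r%:C * z ^+ i)) ^+ j.+1) / j.+1%:R) =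
     (if j.+1 == k then 2^-1 * s * N%:R * complex.Re ((v * r%:C) ^+ j.+1) else 0) / j.+1%:R.
    rewrite -(sum_weight_Re _ _ hz)//; last by have := ltn_ord j; rewrite /N; lia.
    rewrite mulr_suml; apply: eq_bigr => i _.
    by rewrite -mulrA (mulrA v) exprMn.
  rewrite (eq_bigr _ (fun j _ => E j)) (bigD1 (Ordinal kL'))//= prednK// eqxx.
  rewrite big1 ?addr0// => j jk.
  by case: eqP => [jk'|]; rewrite ?mul0r//; case/eqP: jk; apply/val_inj; rewrite /= -jk'.
rewrite mulrDr -lerBlDr; apply: le_trans Lo; rewrite le_eqVlt; apply/orP; left; apply/eqP.
have Ec (c : R) : \sum_(v <- vs) c = (size vs)%:R * c.
  by rewrite big_const_seq count_predT iter_addr_0 mulr_natl.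
under [RHS]eq_bigr => l _ do rewrite sumrB sumrN Ec mulrBr mulrN mulr_sumr.
rewrite sumrB sumrN exchange_big /= -mulr_suml sumW (eq_bigr _ (fun v _ => ET v)).
rewrite -mulr_suml -mulr_sumr.
have -> : \sum_(v <- vs) complex.Re ((v * r%:C) ^+ k) = r ^+ k * S.
  rewrite mulr_sumr; apply: eq_bigr => v _.
  by rewrite exprMn mulrC -rmorphXn ReZ.
by rewrite [r ^+ L.+1]exprS; ring.
Qed.

End PowerSums.

(** * The Joukowski map and monic polynomials on a segment *)

Section Joukowski.
Context (R : realType) (m h : R).
Hypothesis h0 : 0 < h.
Implicit Types (z w u v : R[i]).

Definition joukowski w : R[i] := m%:C + (h / 2)%:C * (w + w^-1).

Lemma joukowski_unit w : cabs w = 1 ->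
  joukowski w = (m + h * complex.Re w)%:C.
Proof.
move=> w1; rewrite /joukowski -unit_conj//; case: w {w1} => a b /=.
by rewrite rmorphD; congr (_ + _); simpc; congr (_ +i* _); field.
Qed.

Lemma joukowski_unit_itv w : cabs w = 1 ->
  m - h <= m + h * complex.Re w <= m + h.
Proof.
move=> w1; have := normr_Re w; rewrite w1 ler_norml => /andP[a b].
by rewrite !lerD2l -{1}mulrN1 !ler_pM2l// -[X in _ && (_ <= X)]mulr1 ler_pM2l// a b.
Qed.

Lemma joukowski_unit_surj (x : R) : m - h <= x <= m + h ->
  exists2 w, cabs w = 1 & joukowski w = x%:C /\ m + h * complex.Re w = x.
Proof.
move=> /andP[xl xr]; pose c := (x - m) / h.
have c1 : c ^+ 2 <= 1.
  have cl : -1 <= c by rewrite ler_pdivlMr//; lra.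
  have cr : c <= 1 by rewrite ler_pdivrMr//; lra.
  nra.
pose w : R[i] := c +i* Num.sqrt (1 - c ^+ 2).
have w1 : cabs w = 1.
  apply/eqP; rewrite -(@pexpr_eq1 _ _ 2)// ?cabs_ge0// cabs_sqr /=.
  by rewrite sqr_sqrtr ?subr_ge0// addrC subrK.
have wx : m + h * complex.Re w = x by rewrite /= /c; field; rewrite gt_eqF.
by exists w => //; rewrite joukowski_unit// wx.
Qed.

(** The equation u + 1/u = 2 y has the solutions y + s and y - s with s^2 = y^2 - 1. Their product
    is 1, so one of them lies in the closed unit disc. *)
Lemma joukowski_surj z :
  exists2 u, u != 0 /\ cabs u <= 1 & joukowski u = z.
Proof.
have hC : (h / 2)%:C != 0 :> R[i] by rewrite fmorph_eq0 mulf_neq0 ?gt_eqF.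
pose y := (z - m%:C) / (h / 2)%:C / 2.
pose s := sqrtc (y ^+ 2 - 1).
have s2 : s ^+ 2 = y ^+ 2 - 1 by exact: sqr_sqrtc.
have ps : (y + s) * (y - s) = 1 by rewrite mulrC -subr_sqr s2; ring.
have nz : y + s != 0.
  by apply/eqP => E; move: ps; rewrite E mul0r => /esym/eqP; rewrite oner_eq0.
have iE : (y + s)^-1 = y - s by apply: (mulfI nz); rewrite mulfV.
have E u : u + u^-1 = 2 * y -> joukowski u = z.
  by rewrite /joukowski /y => ->; move: (_%:C) hC => c hC; field.
have [le1|gt1] := leP (cabs (y + s)) 1.
  by exists (y + s); [split|apply: E; rewrite iE; ring].
exists (y + s)^-1; last by apply: E; rewrite invrK iE; ring.
by rewrite invr_eq0; split=> //; rewrite cabsV invf_le1 ?cabs_gt0// (ltW gt1).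
Qed.

(** The factorization behind the whole method: multiplied by w, the factor J w - J u becomes a
    quadratic polynomial in w with constant term h/2 and roots u and 1/u. *)
Lemma joukowski_sub u w : u != 0 -> w != 0 ->
  w * (joukowski w - joukowski u) =
  (h / 2)%:C * ((1 - u * w) * (1 - u^-1 * w)).
Proof.
by move=> u0 w0; rewrite /joukowski; field; rewrite u0.
Qed.

(** Its roots are the inverses of the nonzero entries of [vs]; the normalization is the value 1 at
    0. *)
Definition recip_poly (vs : seq R[i]) : {poly R[i]} :=
  \prod_(v <- vs) (1 - v *: 'X).

Lemma horner_recip vs w : (recip_poly vs).[w] = \prod_(v <- vs) (1 - v * w).
Proof.
by rewrite horner_prod; apply: eq_bigr => v _; rewrite !hornerE.
Qed.

Lemma size_recip vs : (size (recip_poly vs) <= (size vs).+1)%N.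
Proof.
rewrite /recip_poly; elim: vs => [|v vs IH]; first by rewrite big_nil size_poly1.
rewrite big_cons (leq_trans (size_polyMleq _ _))//=.
have : (size (1 - v *: 'X : {poly R[i]})%R <= 2)%N.
  rewrite (leq_trans (size_polyD _ _))// size_poly1 size_polyN geq_max/=.
  by rewrite (leq_trans (size_scale_leq _ _))// size_polyX.
by move=> h2; rewrite -subn1 leq_subLR (leq_trans (leq_add h2 IH)).
Qed.

Lemma recip_coef0 vs : (recip_poly vs)`_0 = 1.
Proof.
by rewrite -horner_coef0 horner_recip big1// => v _; rewrite mulr0 subr0.
Qed.

(** A substitute for the maximum principle: bounding every coefficient by M costs a factor [size p],
    which is harmless after n-th roots. *)
Lemma horner_le_size (p : {poly R[i]}) (M : R) w :
  (forall z, cabs z = 1 -> cabs p.[z] <= M) -> cabs w <= 1 ->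
  cabs p.[w] <= (size p)%:R * M.
Proof.
move=> pM w1; rewrite horner_coef (le_trans (cabs_sum _ _ _))//.
rewrite mulr_natl -[X in _ *+ X]card_ord -sumr_const; apply: ler_sum => i _.
rewrite cabsM cabsX -[M]mulr1 ler_pM ?exprn_ge0 ?cabs_ge0 ?coef_bound//.
by rewrite exprn_ile1 ?cabs_ge0.
Qed.

Lemma prod_mul_const (T : Type) (s : seq T) (c : R[i]) (F : T -> R[i]) :
  \prod_(u <- s) (c * F u) = c ^+ size s * \prod_(u <- s) F u.
Proof.
elim: s => [|u s IH]; first by rewrite !big_nil mulr1.
by rewrite !big_cons IH exprS /=; ring.
Qed.

Variable us : seq R[i].
Hypothesis us0 : {in us, forall u, u != 0}.
Let d := size us.
Let q := \prod_(u <- us) ('X - (joukowski u)%:P).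
Variable B : R.
Hypothesis qB : forall x, m - h <= x <= m + h -> cabs q.[x%:C] <= B.
Let inv_us := [seq u^-1 | u <- us].
Let conj_us := [seq u^*%C | u <- us].

Let qE w : q.[w] = \prod_(u <- us) (w - joukowski u).
Proof. by rewrite /q horner_prod; apply: eq_bigr => u _; rewrite !hornerE. Qed.

Let h20 : 0 < h / 2. Proof. by rewrite divr_gt0. Qed.

Lemma cabs_recip_inv w : w != 0 ->
  (h / 2) ^+ d * cabs (recip_poly (us ++ inv_us)).[w] =
  cabs w ^+ d * cabs q.[joukowski w].
Proof.
move=> w0; have -> : (h / 2) ^+ d = cabs ((h / 2)%:C ^+ d).
  by rewrite cabsX cabs_real ger0_norm// ltW.
rewrite -cabsX -!cabsM horner_recip qE; congr cabs.
rewrite big_cat big_map /= -big_split /= -!prod_mul_const.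
by apply: eq_big_seq => u /us0 u0; rewrite joukowski_sub.
Qed.

Lemma cabs_recip_inv_le w : cabs w = 1 ->
  (h / 2) ^+ d * cabs (recip_poly (us ++ inv_us)).[w] <= B.
Proof.
move=> w1; have w0 : w != 0 by rewrite -cabs_gt0 w1.
rewrite cabs_recip_inv// w1 expr1n mul1r joukowski_unit//.
by apply: qB; apply: joukowski_unit_itv.
Qed.

(** On the unit circle |u| |1 - w/u| = |1 - conj(u) w|. A root at u is thus moved to its mirror
    image 1/conj(u), at the price of the factor |u|. *)
Lemma cabs_recip_conj_le w : cabs w = 1 ->
  (h / 2) ^+ d * cabs (recip_poly (us ++ conj_us)).[w] <=
    B * \prod_(u <- us) cabs u.
Proof.
move=> w1.
have w0 : w != 0 by rewrite -cabs_gt0 w1.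
suff -> : cabs (recip_poly (us ++ conj_us)).[w] =
    cabs (recip_poly (us ++ inv_us)).[w] * \prod_(u <- us) cabs u.
  rewrite mulrA ler_wpM2r ?cabs_recip_inv_le//.
  by apply: prodr_ge0 => u _; exact: cabs_ge0.
rewrite !horner_recip !big_cat !big_map /= !cabsM -mulrA; congr (_ * _).
rewrite !cabs_prod -big_split /=; apply: eq_big_seq => u /us0 u0.
rewrite -cabsM mulrBl mul1r mulrAC mulVf// mul1r cabsB.
rewrite -[LHS]cabs_conj -[LHS]mul1r -{1}w1 -cabsM; congr cabs.
rewrite rmorphB rmorph1 rmorphM/= conjcK unit_conj//.
by rewrite mulrBr mulr1 mulrCA mulfV// mulr1.
Qed.

(* Jensen's inequality, read off the constant coefficient. *)
Lemma prod_cabs_ge : (h / 2) ^+ d <= B * \prod_(u <- us) cabs u.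
Proof.
have h2d : 0 < (h / 2) ^+ d by rewrite exprn_gt0.
have : cabs (recip_poly (us ++ conj_us))`_0 <= ((h / 2) ^+ d)^-1 * (B * \prod_(u <- us) cabs u).
  apply: coef_bound => w w1.
  by rewrite -(ler_pM2l h2d) mulrA mulfV ?gt_eqF// mul1r cabs_recip_conj_le.
by rewrite recip_coef0 cabs1 ler_pdivlMl// mulr1.
Qed.

(** A Bernstein-Walsh inequality: w^d q(J w) is a polynomial of degree at most 2d in w, bounded by B
    on the unit circle since J maps the circle into the segment. *)
Lemma monic_growth w : w != 0 -> cabs w <= 1 ->
  cabs w ^+ d * cabs q.[joukowski w] <= (d.*2.+1)%:R * B.
Proof.
move=> w0 w1; rewrite -cabs_recip_inv//.
have h2d : 0 < (h / 2) ^+ d by rewrite exprn_gt0.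
have B0 : 0 <= B.
  apply: le_trans (qB (x := m) _); first exact: cabs_ge0.
  by rewrite lerBlDr lerDl (ltW h0).
rewrite -ler_pdivlMl//; apply: le_trans (horner_le_size (M := ((h / 2) ^+ d)^-1 * B) _ w1) _.
  by move=> z z1; rewrite ler_pdivlMl// cabs_recip_inv_le.
rewrite [leRHS]mulrCA ler_wpM2r ?mulr_ge0 ?invr_ge0 ?(ltW h2d)//.
by rewrite ler_nat (leq_trans (size_recip _))// size_cat size_map addnn.
Qed.

Hypothesis us1 : {in us, forall u, cabs u <= 1}.

(** Applies [power_sum_bound] to the u together with their conjugates. Both have the same real power
    sums, which cancels the factor 2 there; the product of the |u| is at most 1 and is dropped. *)
Lemma zero_power_sum_le (k : nat) : (0 < k)%N ->
  `|\sum_(u <- us) complex.Re (u ^+ k)| <=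
    k%:R * ln ((d.*2.+1)%:R * (B / (h / 2) ^+ d)).
Proof.
move=> k0; have h2d : 0 < (h / 2) ^+ d by rewrite exprn_gt0.
have B0 : 0 <= B.
  apply: le_trans (qB (x := m) _); first exact: cabs_ge0.
  by rewrite lerBlDr lerDl (ltW h0).
have P1 : \prod_(u <- us) cabs u <= 1.
  rewrite big_seq; apply: prodr_ile1 => u uus.
  by rewrite cabs_ge0 us1.
have := @power_sum_bound R (us ++ conj_us) ((d.*2.+1)%:R * (B / (h / 2) ^+ d)) k k0.
rewrite big_cat big_map /=.
under [X in _ + X]eq_bigr => u _ do rewrite -rmorphXn complexRe_conj.
set A := \sum_(u <- us) _; have -> : A + A = 2 * A by ring.
rewrite normrM normr_nat -mulrA ler_pM2l ?ltr0n//; apply.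
  move=> v; rewrite mem_cat => /orP[/us1//|/mapP[u /us1 u1 ->]].
  by rewrite cabs_conj.
move=> w w1; rewrite -cabs_prod -horner_recip.
apply: le_trans (horner_le_size (M := B / (h / 2) ^+ d) _ (ltW w1)) _.
  move=> z z1; rewrite ler_pdivlMr// mulrC (le_trans (cabs_recip_conj_le z1))//.
  by rewrite ler_piMr.
rewrite ler_wpM2r ?divr_ge0 ?(ltW h2d)//.
by rewrite ler_nat (leq_trans (size_recip _))// size_cat size_map addnn.
Qed.

End Joukowski.

(** * Capacity bound and Markov-type inequality for monic polynomials *)

Section ZeroSequence.
Context (R : realType) (m h : R).
Hypothesis h0 : 0 < h.
Implicit Types (z w u v : R[i]) (q : {poly R[i]}).

Lemma zerosP q : q = lead_coef q *: \prod_(z <- zeros q) ('X - z%:P).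
Proof. exact: (svalP (closed_field_poly_normal q)). Qed.

Lemma size_zeros q : q != 0 -> size (zeros q) = (size q).-1.
Proof.
move=> q0; have := congr1 (fun p : {poly R[i]} => size p) (zerosP q).
by rewrite size_scale ?lead_coef_eq0// size_prod_XsubC => ->.
Qed.

Lemma zeros_joukowski q : exists us : seq R[i],
  [/\ {in us, forall u, u != 0}, {in us, forall u, cabs u <= 1} &
      zeros q = [seq joukowski m h u | u <- us]].
Proof.
have /choice[f Hf] : forall z, exists u, [/\ u != 0, cabs u <= 1 & joukowski m h u = z].
  by move=> z; have [u [u0 u1] uz] := joukowski_surj m h0 z; exists u.
exists [seq f z | z <- zeros q]; split.
- by move=> u /mapP[z _ ->]; have [] := Hf z.
- by move=> u /mapP[z _ ->]; have [] := Hf z.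
- rewrite -map_comp -[LHS]map_id; apply: eq_map => z /=.
  by have [] := Hf z.
Qed.

Lemma monic_joukowski q us : q \is monic ->
  zeros q = [seq joukowski m h u | u <- us] ->
  q = \prod_(u <- us) ('X - (joukowski m h u)%:P).
Proof.
by move=> /monicP q1 Ez; rewrite [LHS]zerosP q1 scale1r Ez big_map.
Qed.

Lemma ge_capacity q (B : R) : q \is monic ->
  (forall x, m - h <= x <= m + h -> cabs q.[x%:C] <= B) ->
  (h / 2) ^+ (size q).-1 <= B.
Proof.
move=> q1 qB; have [us [us0 us1 Ez]] := zeros_joukowski q.
have sz : size us = (size q).-1.
  by rewrite -size_zeros ?monic_neq0// Ez size_map.
have Eq := monic_joukowski q1 Ez.
have B0 : 0 <= B.
  apply: le_trans (qB m _); first exact: cabs_ge0.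
  by rewrite lerBlDr lerDl (ltW h0).
rewrite Eq in qB.
rewrite -sz (le_trans (prod_cabs_ge h0 us0 qB))// ler_piMr//.
rewrite big_seq; apply: prodr_ile1 => u uus.
by rewrite cabs_ge0 us1.
Qed.

(* |w| + 1/|w| = |J w - 1| + |J w + 1| for J w = (w + 1/w) / 2, so the image
   of |w| = const is an ellipse with foci +-1. *)
Lemma joukowski_ellipse w (x delta : R) : w != 0 -> m - h <= x <= m + h ->
  cabs (joukowski m h w - x%:C) <= delta ->
  cabs w + (cabs w)^-1 <= 2 + 2 * delta / h.
Proof.
move=> w0 /andP[xl xr] xd.
have W0 : 0 < cabs w by rewrite cabs_gt0.
have E : cabs (w + 1) ^+ 2 + cabs (w - 1) ^+ 2 = 2 * cabs w ^+ 2 + 2.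
  by rewrite !cabs_sqr; case: (w) => a b /=; ring.
have h0C : h%:C != 0 :> R[i] by rewrite fmorph_eq0 gt_eqF.
(* For s = 1 or -1 the difference of J w and the focus m - s h is (h/2) (w + s)^2 / w, so the focal
   distances are governed by |w + 1|^2 and |w - 1|^2. *)
have sqE (s : R) : s ^+ 2 = 1 ->
    h * cabs (w + s%:C) ^+ 2 = 2 * cabs w * cabs (joukowski m h w - (m - s * h)%:C).
  move=> s2; rewrite -cabsX.
  have -> : (w + s%:C) ^+ 2 = 2 * w * (joukowski m h w - (m - s * h)%:C) / h%:C.
    rewrite /joukowski !rmorphB !rmorphM /= fmorphV rmorph_nat.
    have s2C : s%:C ^+ 2 = 1 :> R[i] by rewrite -rmorphXn s2 rmorph1.
    by rewrite sqrrD s2C; field; rewrite h0C w0.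
  rewrite !cabsM cabs_nat cabsV cabs_real gtr0_norm//.
  by field; rewrite gt_eqF.
have tri y : cabs (joukowski m h w - y%:C) <= delta + `|x - y|.
  have -> : joukowski m h w - y%:C = (joukowski m h w - x%:C) + (x - y)%:C.
    by rewrite rmorphB addrA subrK.
  by rewrite (le_trans (cabsD _ _))// cabs_real lerD2r.
have e1 : h * cabs (w + 1) ^+ 2 <= 2 * cabs w * (delta + (x - (m - h))).
  have := sqE 1 (expr1n _ _); rewrite rmorph1 mul1r => ->.
  rewrite ler_wpM2l ?mulr_ge0 ?(ltW W0)//.
  by rewrite (le_trans (tri _))// ger0_norm// subr_ge0.
have e2 : h * cabs (w - 1) ^+ 2 <= 2 * cabs w * (delta + (m + h - x)).
  have := sqE (-1) (etrans (sqrrN _) (expr1n _ _)); rewrite rmorphN rmorph1 mulN1r opprK => ->.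
  rewrite ler_wpM2l ?mulr_ge0 ?(ltW W0)//.
  by rewrite (le_trans (tri _))// distrC ger0_norm// subr_ge0.
have hW : 0 < h * cabs w by rewrite mulr_gt0.
rewrite -(ler_pM2l hW).
have -> : h * cabs w * (cabs w + (cabs w)^-1) = h * (cabs w ^+ 2 + 1).
  by field; rewrite gt_eqF.
have -> : h * cabs w * (2 + 2 * delta / h) = cabs w * (2 * h + 2 * delta).
  by field; rewrite gt_eqF.
have : 2 * (h * (cabs w ^+ 2 + 1)) <= 2 * (cabs w * (2 * h + 2 * delta)).
  have -> : 2 * (h * (cabs w ^+ 2 + 1)) = h * (cabs (w + 1) ^+ 2 + cabs (w - 1) ^+ 2).
    by rewrite E; ring.
  by rewrite mulrDr (le_trans (lerD e1 e2))// -mulrDr; lra.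
by rewrite ler_pM2l.
Qed.

(** The right-hand side 2 + kappa^2 / (1 + kappa) is the value of t + 1/t at t = 1/(1 + kappa), and
    t + 1/t decreases on ]0, 1]. *)
Lemma cabs_ge_of_ellipse (t kappa : R) : 0 < t <= 1 -> 0 < kappa ->
  t + t^-1 <= 2 + kappa ^+ 2 / (1 + kappa) -> 1 <= (1 + kappa) * t.
Proof.
move=> /andP[t0 t1] k0 H; rewrite leNgt; apply/negP => lt1.
have k1 : 0 < 1 + kappa by rewrite addr_gt0.
have tk : 0 < (1 + kappa) * t by rewrite mulr_gt0.
move: H; rewrite -(ler_pM2l tk).
have -> : (1 + kappa) * t * (t + t^-1) = (1 + kappa) * (t ^+ 2 + 1).
  by field; rewrite gt_eqF.
have -> : (1 + kappa) * t * (2 + kappa ^+ 2 / (1 + kappa)) = t * (2 * (1 + kappa) + kappa ^+ 2).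
  by field; rewrite gt_eqF.
move=> H.
have : ((1 + kappa) * t - 1) * (t - (1 + kappa)) <= 0 by nra.
by rewrite nmulr_rle0; lra.
Qed.

(** Cauchy's estimate on the circle of radius delta about x: for J w on it the ellipse condition
    gives |w| >= 1/(1 + kappa), and [monic_growth] bounds q there. The radius is the same for all q,
    so delta^j stays constant as the degree grows. *)
Lemma monic_markov (kappa : R) : 0 < kappa -> exists2 delta, 0 < delta &
  forall q (B : R), q \is monic ->
  (forall x, m - h <= x <= m + h -> cabs q.[x%:C] <= B) ->
  forall j x, m - h <= x <= m + h ->
  delta ^+ j * cabs (q^`N(j)).[x%:C] <=
    ((size q).-1.*2.+1)%:R * (1 + kappa) ^+ (size q).-1 * B.
Proof.
move=> k0; have k1 : 0 < 1 + kappa by rewrite addr_gt0.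
(* Chosen so that 2 delta / h is the excess kappa^2 / (1 + kappa) allowed by
   [cabs_ge_of_ellipse]. *)
pose delta := h * kappa ^+ 2 / (1 + kappa) / 2.
have d0 : 0 < delta by rewrite !divr_gt0 ?mulr_gt0 ?exprn_gt0.
exists delta => // q B q1 qB j x xI.
have [us [us0 us1 Ez]] := zeros_joukowski q.
have sz : size us = (size q).-1.
  by rewrite -size_zeros ?monic_neq0// Ez size_map.
have Eq := monic_joukowski q1 Ez.
have B0 : 0 <= B by apply: le_trans (qB x xI); exact: cabs_ge0.
(* This is q(x + delta y) as a polynomial in y, with the rescaled Taylor coefficients of q at x. *)
pose r : {poly R[i]} := \poly_(i < size q) ((q^`N(i)).[x%:C] * delta%:C ^+ i).
have rE y : r.[y] = q.[x%:C + delta%:C * y].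
  rewrite horner_poly nderiv_taylor; last exact: mulrC.
  by apply: eq_bigr => i _; rewrite exprMn mulrA.
have [jq|jq] := ltnP j (size q); last first.
  have -> : q^`N(j) = 0.
    by apply/polyP => i; rewrite coef_nderivn coef0 nth_default ?mul0rn// (leq_trans jq) ?leq_addr.
  by rewrite horner0 cabs0 mulr0 !mulr_ge0 ?exprn_ge0// ltW.
have -> : delta ^+ j * cabs (q^`N(j)).[x%:C] = cabs r`_j.
  by rewrite coef_poly jq cabsM cabsX cabs_real gtr0_norm// mulrC.
apply: coef_bound => y y1; rewrite rE.
have [w [w0 w1] wE] := joukowski_surj m h0 (x%:C + delta%:C * y).
rewrite -wE -sz.
have W0 : 0 < cabs w by rewrite cabs_gt0.
have wk : 1 <= (1 + kappa) * cabs w.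
  apply: cabs_ge_of_ellipse => //; first by rewrite W0.
  have := @joukowski_ellipse w x delta w0 xI.
  rewrite wE addrAC subrr add0r cabsM y1 mulr1 cabs_real gtr0_norm// lexx => /(_ isT).
  rewrite /delta; congr (_ <= _ + _); field.
  by rewrite !gt_eqF.
have wk2 : 1 <= (1 + kappa) ^+ size us * cabs w ^+ size us.
  by rewrite -exprMn exprn_ege1.
apply: le_trans (_ : _ <= (1 + kappa) ^+ size us * (cabs w ^+ size us * cabs q.[joukowski m h w])) _.
  by rewrite mulrA ler_peMl ?cabs_ge0.
rewrite mulrAC [leRHS]mulrC ler_wpM2l ?exprn_ge0 ?(ltW k1)//.
by rewrite Eq; apply: monic_growth => //; rewrite -Eq.
Qed.

End ZeroSequence.

(** * Chebyshev polynomials of the segment *)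

Section Chebyshev.
Context (R : realType) (m h : R).

(** Carrying two consecutive polynomials makes the three-term recurrence structural. The initial
    value 2 fits the recurrence; the polynomials are monic from index 1 on. *)
Fixpoint cheb_pair (k : nat) : {poly R} * {poly R} :=
  if k is k'.+1 then
    let: (p, q) := cheb_pair k' in
    (q, ('X - m%:P) * q - ((h / 2) ^+ 2) *: p)
  else (2%:P, 'X - m%:P).

(* Scaled so that cheb k (m + h cos t) = 2 (h/2)^k cos (k t). *)
Definition cheb k := (cheb_pair k).1.

Lemma chebSS k :
  cheb k.+2 = ('X - m%:P) * cheb k.+1 - ((h / 2) ^+ 2) *: cheb k.
Proof. by rewrite /cheb /=; case: (cheb_pair k). Qed.

Lemma size_cheb_monic k : size (cheb k) = k.+1 /\ (cheb k.+1 \is monic /\ size (cheb k.+1) = k.+2).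
Proof.
elim: k => [|k [IH1 [IH2 IH3]]].
  rewrite /cheb /= monicXsubC size_XsubC size_polyC.
  by rewrite pnatr_eq0.
split=> //.
have sM : size (('X - m%:P) * cheb k.+1) = k.+3.
  by rewrite size_proper_mul ?size_XsubC ?IH3// (monicP IH2) mulr1 lead_coefXsubC oner_eq0.
have lt : (size (- (((h / 2) ^+ 2) *: cheb k)) < size (('X - m%:P) * cheb k.+1)%R)%N.
  rewrite size_polyN sM (leq_ltn_trans (size_scale_leq _ _))// IH1//.
rewrite chebSS size_polyDl//; split => //.
by rewrite monicE lead_coefDl// lead_coefM (monicP IH2) lead_coefXsubC mulr1.
Qed.

Lemma size_cheb k : size (cheb k) = k.+1.
Proof. by have [] := size_cheb_monic k. Qed.

Lemma cheb_monic k : (0 < k)%N -> cheb k \is monic.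
Proof. by case: k => // k _; have [_ []] := size_cheb_monic k. Qed.

Lemma cheb_unit k (w : R[i]) : cabs w = 1 ->
  (cheb k).[m + h * complex.Re w] = 2 * (h / 2) ^+ k * complex.Re (w ^+ k).
Proof.
move=> w1.
suff: (cheb k).[m + h * complex.Re w] = 2 * (h / 2) ^+ k * complex.Re (w ^+ k) /\
  (cheb k.+1).[m + h * complex.Re w] = 2 * (h / 2) ^+ k.+1 * complex.Re (w ^+ k.+1) by case.
elim: k => [|k [IH1 IH2]].
  rewrite /cheb /= !hornerE /=; split; first by [].
  by rewrite !expr1; field.
split=> //; rewrite chebSS hornerD hornerN hornerZ hornerM hornerXsubC IH1 IH2.
(* The recurrence cos (k+2)t = 2 cos t cos (k+1)t - cos kt, for w = exp(it). *)
have Re2 : complex.Re (w ^+ k.+2) = 2 * complex.Re w * complex.Re (w ^+ k.+1) - complex.Re (w ^+ k).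
  have := cabs_sqr w; rewrite w1 expr1n [w ^+ k.+2]exprS [w ^+ k.+1]exprS.
  case: (w) (w ^+ k) => a b [c d] /= H.
  apply/eqP; rewrite -subr_eq0; apply/eqP.
  transitivity (c * (1 - (a ^+ 2 + b ^+ 2))); first by ring.
  by rewrite -H subrr mulr0.
rewrite Re2.
have -> : m + h * complex.Re w - m = 2 * (h / 2) * complex.Re w by field.
move: (complex.Re (w ^+ k.+1)) (complex.Re (w ^+ k)) (complex.Re w) (h / 2) => u v c e.
by rewrite [e ^+ k.+2]exprS [e ^+ k.+1]exprS; move: (e ^+ k) => f; ring.
Qed.

End Chebyshev.

(** * Logarithmic energy on a segment *)

Section LogKernelExpansion.
Context (R : realType) (m h : R).
Hypothesis h0 : 0 < h.
Implicit Types (z w u v s : R[i]) (r x y : R).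

(* The Chebyshev polynomial T_k transported to the segment. *)
Definition tau (k : nat) x : R := (cheb m h k).[x] / (2 * (h / 2) ^+ k).

Lemma tau_unit k w : cabs w = 1 ->
  tau k (m + h * complex.Re w) = complex.Re (w ^+ k).
Proof.
move=> w1; rewrite /tau cheb_unit// mulrAC mulfV ?mul1r//.
by rewrite mulf_neq0 ?pnatr_eq0// expf_neq0// mulf_neq0 ?invr_eq0 ?pnatr_eq0// gt_eqF.
Qed.

Lemma tau_le1 k x : m - h <= x <= m + h -> `|tau k x| <= 1.
Proof.
move=> /(joukowski_unit_surj h0)[w w1 [_ <-]]; rewrite tau_unit//.
by rewrite (le_trans (normr_Re _))// cabsX w1 expr1n.
Qed.

(** Partial sum of the Chebyshev expansion of - ln |x - y|, with Abel factors r^k that make the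
    remainder geometric. *)
Definition log_partial r (L : nat) x y : R :=
  - ln (h / 2) +
  \sum_(k < L) 2 * r ^+ k.+1 / k.+1%:R * (tau k.+1 x * tau k.+1 y).

Lemma joukowski_dist w v : cabs w = 1 -> cabs v = 1 ->
  `|(m + h * complex.Re w) - (m + h * complex.Re v)| =
  h / 2 * (cabs (1 - w * v) * cabs (1 - w * v^*%C)).
Proof.
move=> w1 v1.
have w0 : w != 0 by rewrite -cabs_gt0 w1.
have v0 : v != 0 by rewrite -cabs_gt0 v1.
rewrite -cabs_real.
have -> : ((m + h * complex.Re w) - (m + h * complex.Re v))%:C = joukowski m h w - joukowski m h v.
  by rewrite !joukowski_unit// rmorphB.
rewrite -[LHS]mul1r -{1}w1 -cabsM joukowski_sub// !cabsM cabs_real.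
rewrite ger0_norm ?divr_ge0 ?(ltW h0)//.
by rewrite unit_conj// [v * w]mulrC [v^-1 * w]mulrC.
Qed.

(** The logarithmic series at r w v and at r w conj(v) combine into products T_k(x) T_k(y), because
    Re (w v)^k + Re (w conj(v))^k = 2 Re w^k Re v^k. *)
Lemma log_partial_trunc r L w v : 0 < r < 1 -> cabs w = 1 -> cabs v = 1 ->
  `|log_partial r L (m + h * complex.Re w) (m + h * complex.Re v) -
    (- ln (h / 2) - ln (cabs (1 - r%:C * (w * v)))
       - ln (cabs (1 - r%:C * (w * v^*%C))))| <= 2 * (r ^+ L.+1 / (1 - r)).
Proof.
move=> /andP[r0 r1] w1 v1.
have T s : cabs s = 1 ->
  `|ln (cabs (1 - r%:C * s)) + \sum_(k < L) complex.Re ((r%:C * s) ^+ k.+1) / k.+1%:R|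
    <= r ^+ L.+1 / (1 - r).
  move=> s1; have rs : cabs (r%:C * s) = r by rewrite cabsM s1 mulr1 cabs_real gtr0_norm.
  by have := @ln_cabs_trunc _ (r%:C * s) L; rewrite rs; apply.
have wv1 : cabs (w * v) = 1 by rewrite cabsM w1 v1 mulr1.
have wv1' : cabs (w * v^*%C) = 1 by rewrite cabsM cabs_conj w1 v1 mulr1.
have := T _ wv1; have := T _ wv1'.
set a := ln (cabs (1 - r%:C * (w * v))).
set b := ln (cabs (1 - r%:C * (w * v^*%C))).
set A := \sum_(k < L) complex.Re ((r%:C * (w * v)) ^+ k.+1) / k.+1%:R.
set B := \sum_(k < L) complex.Re ((r%:C * (w * v^*%C)) ^+ k.+1) / k.+1%:R.
move=> hb ha.
have -> : log_partial r L (m + h * complex.Re w) (m + h * complex.Re v) = - ln (h / 2) + (A + B).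
  rewrite /log_partial /A /B -big_split /=; congr (_ + _).
  apply: eq_bigr => k _; rewrite !tau_unit// -mulrDl.
  rewrite mulrAC; congr (_ / _).
  rewrite !exprMn -!rmorphXn !ReZ -mulrDr.
  have -> : complex.Re (w ^+ k.+1 * v ^+ k.+1) + complex.Re (w ^+ k.+1 * ((v ^+ k.+1)^*)%C) =
     2 * (complex.Re (w ^+ k.+1) * complex.Re (v ^+ k.+1)).
    by case: (w ^+ _) (v ^+ _) => c d [e f] /=; ring.
  by ring.
by move: ha hb; rewrite !ler_norml => /andP[? ?] /andP[? ?]; apply/andP; split; lra.
Qed.

Lemma cabs_1Br_ge r s : 0 <= r <= 1 -> cabs s = 1 ->
  r * cabs (1 - s) ^+ 2 <= cabs (1 - r%:C * s) ^+ 2.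
Proof.
move=> /andP[r0 r1] s1.
have -> : cabs (1 - r%:C * s) ^+ 2 = (1 - r) ^+ 2 + r * cabs (1 - s) ^+ 2.
  have := cabs_sqr s; rewrite s1 expr1n !cabs_sqr.
  case: (s) => a b /= E.
  apply/eqP; rewrite -subr_eq0; apply/eqP.
  transitivity ((r - r ^+ 2) * (1 - (a ^+ 2 + b ^+ 2))); first by ring.
  by rewrite -E subrr mulr0.
by rewrite lerDr sqr_ge0.
Qed.

(** By [cabs_1Br_ge], replacing 1 - r s by 1 - s costs (ln r)/2 in each of the two logarithms; the
    total ln r vanishes as r tends to 1. *)
Lemma log_partial_le r L x y : 0 < r < 1 ->
  m - h <= x <= m + h -> m - h <= y <= m + h -> x != y ->
  log_partial r L x y - 2 * (r ^+ L.+1 / (1 - r)) + ln r <= - ln `|x - y|.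
Proof.
move=> r01 /(joukowski_unit_surj h0)[w w1 [_ <-]] /(joukowski_unit_surj h0)[v v1 [_ <-]] xy.
have /andP[r0 r1] := r01.
have := log_partial_trunc L r01 w1 v1; rewrite ler_norml => /andP[_].
have := joukowski_dist w1 v1 => dE.
have d0 : 0 < `|(m + h * complex.Re w) - (m + h * complex.Re v)|.
  by rewrite normr_gt0 subr_eq0.
have wv1 : cabs (w * v) = 1 by rewrite cabsM w1 v1 mulr1.
have wv1' : cabs (w * v^*%C) = 1 by rewrite cabsM cabs_conj w1 v1 mulr1.
have h20 : 0 < h / 2 by rewrite divr_gt0.
rewrite dE in d0 *.
have pa : 0 < cabs (1 - w * v).
  by rewrite lt_def cabs_ge0 andbT; apply: contraTneq d0 => ->; rewrite mul0r mulr0 ltxx.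
have pb : 0 < cabs (1 - w * v^*%C).
  by rewrite lt_def cabs_ge0 andbT; apply: contraTneq d0 => ->; rewrite !mulr0 ltxx.
have lnb s : cabs s = 1 -> 0 < cabs (1 - s) ->
   2^-1 * ln r + ln (cabs (1 - s)) <= ln (cabs (1 - r%:C * s)).
  move=> s1 s0.
  have rs0 : 0 < cabs (1 - r%:C * s).
    by apply: cabs_1B_gt0; rewrite cabsM s1 mulr1 cabs_real gtr0_norm.
  have s20 : 0 < cabs (1 - s) ^+ 2 by rewrite exprn_gt0.
  rewrite [ln (cabs (1 - s))]ln_cabs [leRHS]ln_cabs -mulrDr ler_pM2l//.
  rewrite -lnM// ler_ln ?posrE ?(mulr_gt0 r0) ?exprn_gt0//.
  by apply: cabs_1Br_ge => //; rewrite !ltW.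
have la := lnb _ wv1 pa; have lb := lnb _ wv1' pb.
rewrite [ln (_ * (_ * _))]lnM ?posrE ?mulr_gt0// [ln (cabs _ * cabs _)]lnM ?posrE//.
by move: la lb; lra.
Qed.

(* The shift by eta makes the kernel bounded, so that Fatou's lemma applies
   as eta tends to 0. *)
Lemma log_partial_ge r L x y eta : 0 < r < 1 ->
  m - h <= x <= m + h -> m - h <= y <= m + h ->
  (5 * (h / 2)) * (1 - r) <= eta ->
  - ln (`|x - y| + eta) <= log_partial r L x y + 2 * (r ^+ L.+1 / (1 - r)).
Proof.
move=> r01 /(joukowski_unit_surj h0)[w w1 [_ <-]] /(joukowski_unit_surj h0)[v v1 [_ <-]] re.
have /andP[r0 r1] := r01.
have := log_partial_trunc L r01 w1 v1; rewrite ler_norml => /andP[+ _].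
have dE := joukowski_dist w1 v1.
have wv1 : cabs (w * v) = 1 by rewrite cabsM w1 v1 mulr1.
have wv1' : cabs (w * v^*%C) = 1 by rewrite cabsM cabs_conj w1 v1 mulr1.
have h20 : 0 < h / 2 by rewrite divr_gt0.
rewrite dE.
have pr s : cabs s = 1 -> 0 < cabs (1 - r%:C * s).
  by move=> s1; apply: cabs_1B_gt0; rewrite cabsM s1 mulr1 cabs_real gtr0_norm.
have up s : cabs s = 1 -> cabs (1 - r%:C * s) <= cabs (1 - s) + (1 - r).
  move=> s1; have -> : 1 - r%:C * s = (1 - s) + (1 - r)%:C * s.
    by rewrite rmorphB rmorph1; ring.
  rewrite (le_trans (cabsD _ _))// cabsM s1 mulr1 cabs_real ger0_norm// subr_ge0 ltW//.
have up2 s : cabs s = 1 -> cabs (1 - s) <= 2.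
  by move=> s1; rewrite (le_trans (cabsD _ _))// cabsN s1 cabs1.
have := up _ wv1; have := up _ wv1'; have := up2 _ wv1; have := up2 _ wv1'.
have := pr _ wv1; have := pr _ wv1'.
have := cabs_ge0 (1 - w * v); have := cabs_ge0 (1 - w * v^*%C).
move: (cabs (1 - w * v)) (cabs (1 - w * v^*%C)) => a b.
move: (cabs (1 - r%:C * _)) (cabs (1 - r%:C * _)) => b' a'.
move=> b0 a0 b'0 a'0 b2 a2 bb aa H.
(* The constant 5: a' <= a + (1 - r) and b' <= b + (1 - r) with a, b <= 2 give a' b' <= a b + 4 (1 -
   r) + (1 - r)^2. *)
have ab : h / 2 * (a' * b') <= h / 2 * (a * b) + eta.
  apply: le_trans (_ : _ <= h / 2 * (a * b) + 5 * (h / 2) * (1 - r)) _; last by rewrite lerD2l.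
  have -> : h / 2 * (a * b) + 5 * (h / 2) * (1 - r) = h / 2 * (a * b + 5 * (1 - r)) by ring.
  rewrite ler_pM2l//; nra.
have : ln (h / 2 * (a' * b')) <= ln (h / 2 * (a * b) + eta).
  have p0 : 0 < h / 2 * (a' * b') by rewrite !mulr_gt0.
  by rewrite ler_ln ?posrE// (lt_le_trans p0).
rewrite [ln (_ * (_ * _))]lnM ?posrE ?mulr_gt0// [ln (a' * b')]lnM ?posrE//.
by move: H; lra.
Qed.

End LogKernelExpansion.

(** * Integration lemmas *)

Section MeasureGeneralities.
Context (R : realType).

(** Positive and negative parts are compared separately, which admits integrands with infinite
    values such as the logarithmic kernel. *)
Lemma le_integral_measurable d (T : measurableType d)
    (mu : {measure set T -> \bar R}) (D : set T) (f g : T -> \bar R) :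
  measurable D -> measurable_fun D f -> measurable_fun D g ->
  (forall x, D x -> (f x <= g x)%E) ->
  (\int[mu]_(x in D) f x <= \int[mu]_(x in D) g x)%E.
Proof.
move=> mD mf mg fg; rewrite integralE [leRHS]integralE; apply: leeB.
  apply: ge0_le_integral => //.
  - exact: measurable_funepos.
  - exact: measurable_funepos.
  - by move=> x Dx; rewrite !funeposE ge_max le_max fg//= le_max lexx orbT.
apply: ge0_le_integral => //.
- exact: measurable_funeneg.
- exact: measurable_funeneg.
- by move=> x Dx; rewrite !funenegE ge_max le_max leeN2 fg//= le_max lexx orbT.
Qed.

Lemma integral_conull d (T : measurableType d)
    (mu : {measure set T -> \bar R}) (D : set T) (f : T -> \bar R) :
  measurable D -> measurable_fun setT f -> mu (~` D) = 0%E ->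
  (\int[mu]_x f x = \int[mu]_(x in D) f x)%E.
Proof.
move=> mD mf D0; rewrite [RHS]integral_mkcond; apply: ae_eq_integral => //.
  by apply/(measurable_restrictT _ mD); exact: measurable_funTS.
exists (~` D); split => //; first exact: measurableC.
move=> x /= H Dx; apply: H => _.
by rewrite patchE mem_set.
Qed.

Lemma bounded_prob_integrable d (T : measurableType d)
    (nu : probability T R) (f : T -> R) (C : R) :
  measurable_fun setT f -> (forall x, `|f x| <= C) ->
  nu.-integrable setT (EFin \o f).
Proof.
move=> mf fC; apply: measurable_bounded_integrable => //.
  exact: le_lt_trans (probability_le1 nu measurableT) (ltry 1).
exists C; split; first exact: num_real.
by move=> M CM x _; exact: le_trans (fC x) (ltW CM).
Qed.

Lemma EFin_Rintegral d (T : measurableType d) (nu : {measure set T -> \bar R})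
    (D : set T) (f : T -> R) : measurable D ->
  nu.-integrable D (EFin \o f) ->
  (\int[nu]_(x in D) (f x)%:E)%E = (\int[nu]_(x in D) f x)%:E.
Proof.
move=> mD fi; rewrite /Rintegral fineK//.
exact: integrable_fin_num.
Qed.

Lemma prob_integral_lin d (T : measurableType d) (nu : probability T R)
    (c : R) (L : nat) (a : nat -> R) (F : nat -> T -> R) :
  (forall k, measurable_fun setT (F k)) -> (forall k x, `|F k x| <= 1) ->
  (\int[nu]_x (c + \sum_(k < L) a k * F k x)%:E)%E =
  (c + \sum_(k < L) a k * \int[nu]_x F k x)%:E.
Proof.
move=> mF F1.
have iF k : nu.-integrable setT (EFin \o F k) by exact: bounded_prob_integrable (mF k) (F1 k).
elim: L => [|L IH].
  under eq_integral do rewrite big_ord0 addr0.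
  by rewrite integral_cst//= probability_setT mule1 big_ord0 addr0.
have ms : measurable_fun setT (fun x => c + \sum_(k < L) a k * F k x).
  apply: measurable_funD => //; apply: measurable_sum => k.
  exact: measurable_funM.
have is1 : nu.-integrable setT (EFin \o (fun x => c + \sum_(k < L) a k * F k x)).
  apply: (@bounded_prob_integrable _ _ _ _ (`|c| + \sum_(k < L) `|a k|)) => // x.
  rewrite (le_trans (ler_normD _ _))// lerD2l (le_trans (ler_norm_sum _ _ _))//.
  by apply: ler_sum => k _; rewrite normrM ler_piMr.
have is2 : nu.-integrable setT (fun x => (a L)%:E * (F L x)%:E)%E by have := integrableZl measurableT (a L) (iF L).
have I2 : (\int[nu]_x ((a L)%:E * (F L x)%:E) = (a L * \int[nu]_x F L x)%:E)%E.
  by rewrite EFinM -EFin_Rintegral//; exact: (integralZl measurableT (iF L) (a L)).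
transitivity (\int[nu]_x ((c + \sum_(k < L) a k * F k x)%:E + (a L)%:E * (F L x)%:E))%E.
  by apply: eq_integral => x _; rewrite big_ord_recr /= addrA EFinD EFinM.
by rewrite integralD// IH I2 -EFinD big_ord_recr /= addrA.
Qed.

End MeasureGeneralities.

(** * Chebyshev moments and the energy integral *)

Section Energy.
Context (R : realType) (m h : R).
Hypothesis h0 : 0 < h.
Implicit Types (x y r : R) (z w : R * R).

Definition seg : set R := [set x | m - h <= x <= m + h].
Let E := real_in_plane seg.

Lemma seg_itv : seg = `[m - h, m + h]%classic.
Proof. by apply/seteqP; split => x /=; rewrite in_itv. Qed.

Lemma real_in_plane_prod (D : set R) : real_in_plane D = D `*` [set 0].
Proof. by apply/seteqP; split => -[x y]. Qed.

Lemma measurable_real_in_plane : measurable E.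
Proof.
rewrite /E real_in_plane_prod; apply: measurableX => //.
by rewrite seg_itv; exact: measurable_itv.
Qed.

(* Makes polynomials bounded off the segment without changing them on it. *)
Definition clip x := Num.max (m - h) (Num.min (m + h) x).

Lemma clip_seg x : seg (clip x).
Proof.
rewrite /seg /clip /= le_max lexx/= ge_max ge_min lexx/= andbT.
by rewrite lerD2l ge0_cp// ltW.
Qed.

Lemma clip_id x : seg x -> clip x = x.
Proof.
by move=> /andP[a b]; rewrite /clip min_r// max_r.
Qed.

(** The index is shifted: [clip_tau k] corresponds to T_(k+1), the constant T_0 being left out. *)
Definition clip_tau (k : nat) z := tau m h k.+1 (clip z.1).

Lemma measurable_clip_tau k : measurable_fun setT (clip_tau k).
Proof.
apply: (@measurableT_comp _ _ _ _ _ _ (fun x => tau m h k.+1 (clip x))); last exact: measurable_fst.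
apply: (@measurableT_comp _ _ _ _ _ _ (tau m h k.+1)).
  apply: continuous_measurable_fun => x; apply: cvgM; last exact: cvg_cst.
  exact: continuous_horner.
by apply: measurable_maxr => //; apply: measurable_minr.
Qed.

Lemma clip_tau_le1 k z : `|clip_tau k z| <= 1.
Proof. by apply: tau_le1 => //; exact: clip_seg. Qed.

Lemma clip_tauE k z : E z -> clip_tau k z = tau m h k.+1 z.1.
Proof. by move=> [zs _]; rewrite /clip_tau clip_id. Qed.

Lemma plane_dist (zw : (R * R) * (R * R)) :
  cabs (complex_of_plane zw.1 - complex_of_plane zw.2) =
  Num.sqrt ((zw.1.1 - zw.2.1) ^+ 2 + (zw.1.2 - zw.2.2) ^+ 2).
Proof. by []. Qed.

Lemma measurable_plane_dist : measurable_fun setT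
  (fun zw : (R * R) * (R * R) => cabs (complex_of_plane zw.1 - complex_of_plane zw.2)).
Proof.
apply: (@measurableT_comp _ _ _ _ _ _ (@Num.sqrt R)).
  by apply: continuous_measurable_fun; exact: sqrt_continuous.
have m1 (f g : (R * R) * (R * R) -> R) : measurable_fun setT f -> measurable_fun setT g ->
   measurable_fun setT (fun zw => (f zw - g zw) ^+ 2).
  by move=> mf mg; apply: measurable_funX; exact: measurable_funB.
apply: measurable_funD; apply: m1.
- exact: (measurableT_comp measurable_fst measurable_fst).
- exact: (measurableT_comp measurable_fst measurable_snd).
- exact: (measurableT_comp measurable_snd measurable_fst).
- exact: (measurableT_comp measurable_snd measurable_snd).
Qed.

Lemma complex_of_plane_inj : injective (@complex_of_plane R).
Proof. by move=> [a b] [c d] [-> ->]. Qed.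

Lemma log_kernelE zw : @log_kernel R zw =
  if cabs (complex_of_plane zw.1 - complex_of_plane zw.2) == 0 then +oo%E
  else (- ln (cabs (complex_of_plane zw.1 - complex_of_plane zw.2)))%:E.
Proof.
rewrite /log_kernel cabs_eq0 subr_eq0.
by rewrite (inj_eq complex_of_plane_inj).
Qed.

Lemma measurable_log_kernel : measurable_fun setT (@log_kernel R).
Proof.
rewrite (_ : @log_kernel R = (fun d : R => if d == 0 then +oo%E else (- ln d)%:E) \o
  (fun zw : (R * R) * (R * R) => cabs (complex_of_plane zw.1 - complex_of_plane zw.2))); last first.
  by apply/funext => zw; rewrite log_kernelE.
apply: measurableT_comp; last exact: measurable_plane_dist.
apply: measurable_fun_ifT => //.
  exact: measurable_fun_eqr.
apply/measurable_EFinP; apply: measurable_funN; exact: measurable_ln.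
Qed.

Lemma log_kernel_real x y : @log_kernel R ((x, 0), (y, 0)) =
  if x == y then +oo%E else (- ln `|x - y|)%:E.
Proof.
rewrite /log_kernel plane_dist xpair_eqE eqxx andbT /= subrr expr0n addr0.
by rewrite sqrtr_sqr.
Qed.

Definition clip_log r L (zw : (R * R) * (R * R)) : R :=
  - ln (h / 2) +
  \sum_(k < L) 2 * r ^+ k.+1 / k.+1%:R * (clip_tau k zw.1 * clip_tau k zw.2).

Lemma measurable_clip_log r L : measurable_fun setT (clip_log r L).
Proof.
apply: measurable_funD => //; apply: measurable_sum => k.
apply: measurable_funM => //; apply: measurable_funM.
  exact: (measurableT_comp (@measurable_clip_tau k) measurable_fst).
exact: (measurableT_comp (@measurable_clip_tau k) measurable_snd).
Qed.

Lemma clip_logE r L (zw : (R * R) * (R * R)) : (E `*` E) zw ->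
  clip_log r L zw = log_partial m h r L zw.1.1 zw.2.1.
Proof.
move=> [E1 E2]; congr (_ + _); apply: eq_bigr => k _.
by rewrite !clip_tauE.
Qed.

Lemma clip_log_bounded r L : exists C, forall zw, `|clip_log r L zw| <= C.
Proof.
exists (`|ln (h / 2)| + \sum_(k < L) `|2 * r ^+ k.+1 / k.+1%:R|) => zw.
rewrite (le_trans (ler_normD _ _))// normrN lerD2l.
rewrite (le_trans (ler_norm_sum _ _ _))//; apply: ler_sum => k _.
rewrite normrM ler_piMr// normrM -[leRHS]mul1r.
by apply: ler_pM => //; exact: clip_tau_le1.
Qed.

Variable nu : probability (R * R)%type R.

(** Each term is a product of a function of x and the same function of y, so by Fubini it integrates
    to the square of a Chebyshev moment. *)
Lemma integral_clip_log r L :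
  (\int[(nu \x nu)%E]_zw (clip_log r L zw)%:E)%E =
  (- ln (h / 2) +
   \sum_(k < L) 2 * r ^+ k.+1 / k.+1%:R * (\int[nu]_z clip_tau k z) ^+ 2)%:E.
Proof.
have [C HC] := clip_log_bounded r L.
have ic : (nu \x nu)%E.-integrable setT (EFin \o clip_log r L).
  pose nn : probability _ R := (nu \x nu)%E.
  exact: (@bounded_prob_integrable _ _ _ nn _ _ (measurable_clip_log r L) HC).
rewrite -(integral12_prod_meas1 ic).
transitivity (\int[nu]_z (- ln (h / 2) + \sum_(k < L) (2 * r ^+ k.+1 / k.+1%:R * (\int[nu]_w clip_tau k w)) * clip_tau k z)%:E)%E.
  apply: eq_integral => z _; rewrite /fubini_F.
  transitivity (\int[nu]_w (- ln (h / 2) + \sum_(k < L) (2 * r ^+ k.+1 / k.+1%:R * clip_tau k z) * clip_tau k w)%:E)%E.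
    apply: eq_integral => w _ /=; congr (_ + _)%:E; apply: eq_bigr => k _ /=.
    by rewrite mulrA.
  rewrite (prob_integral_lin nu _ L (fun k => 2 * r ^+ k.+1 / k.+1%:R * clip_tau k z) measurable_clip_tau clip_tau_le1).
  by congr (_ + _)%:E; apply: eq_bigr => k _; rewrite mulrAC.
rewrite (prob_integral_lin nu _ L (fun k => 2 * r ^+ k.+1 / k.+1%:R * \int[nu]_w clip_tau k w) measurable_clip_tau clip_tau_le1).
by congr (_ + _)%:E; apply: eq_bigr => k _; rewrite -mulrA.
Qed.

Hypothesis nuE : nu E = 1%E.

Let mEE : measurable (E `*` E).
Proof. by apply: measurableX; exact: measurable_real_in_plane. Qed.

Lemma prod_conull : (nu \x nu)%E (~` (E `*` E)) = 0%E.
Proof.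
rewrite (probability_setC (nu \x nu)%E)//=.
rewrite product_measure1E; try exact: measurable_real_in_plane.
transitivity (1 - 1 * 1 : \bar R)%E; last by rewrite mule1 subee.
by congr (_ - _ * _)%E; exact: nuE.
Qed.

End Energy.

(** * Lower bounds for the energy *)

Section EnergyLower.
Context (R : realType) (m h : R).
Hypothesis h0 : 0 < h.
Let E := real_in_plane (seg m h).
Variable nu : probability (R * R)%type R.
Hypothesis nuE : nu E = 1%E.
Let nn : probability _ R := (nu \x nu)%E.

Let mEE : measurable (E `*` E).
Proof. by apply: measurableX; exact: measurable_real_in_plane. Qed.

Let log_energyE : log_energy nu = (\int[nn]_(zw in E `*` E) log_kernel zw)%E.
Proof.
apply: (@integral_conull _ _ _ nn) => //; first exact: measurable_log_kernel.
exact: prod_conull.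
Qed.

Lemma integral_clip_log_on r L (c : R) :
  (\int[nn]_(zw in E `*` E) (clip_log m h r L zw + c)%:E)%E =
  (- ln (h / 2) +
   \sum_(k < L) 2 * r ^+ k.+1 / k.+1%:R * (\int[nu]_z clip_tau m h k z) ^+ 2 + c)%:E.
Proof.
have mc : measurable_fun setT (clip_log m h r L) by exact: measurable_clip_log.
rewrite -(@integral_conull _ _ _ nn)//; last exact: prod_conull.
  have [C HC] := clip_log_bounded m h0 r L.
  have ic : nn.-integrable setT (EFin \o clip_log m h r L).
    exact: (@bounded_prob_integrable _ _ _ nn _ _ mc HC).
  have ik : nn.-integrable setT (EFin \o (fun=> c)).
    by apply: (@bounded_prob_integrable _ _ _ nn _ `|c|).
  rewrite (eq_integral (fun zw => ((clip_log m h r L zw)%:E + c%:E)%E)) => [|zw _]; last by rewrite EFinD.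
  rewrite integralD// (integral_clip_log m h0) [RHS]EFinD; congr (_ + _)%E.
  by rewrite integral_cst//= probability_setT mule1.
apply/measurable_EFinP; exact: measurable_funD.
Qed.

Lemma log_energy_ge_trunc r L : 0 < r < 1 ->
  ((- ln (h / 2) +
   \sum_(k < L) 2 * r ^+ k.+1 / k.+1%:R * (\int[nu]_z clip_tau m h k z) ^+ 2 +
   (ln r - 2 * (r ^+ L.+1 / (1 - r))))%:E <= log_energy nu)%E.
Proof.
move=> r01; rewrite -integral_clip_log_on log_energyE.
apply: le_integral_measurable => //.
- apply: measurable_funTS; apply/measurable_EFinP; apply: measurable_funD => //.
  exact: measurable_clip_log.
- by apply: measurable_funTS; exact: measurable_log_kernel.
move=> [[x x2] [y y2]] EE; rewrite clip_logE//.
case: EE => -[/= xs x20] [/= ys y20]; rewrite x20 y20 log_kernel_real.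
case: eqP => [_|/eqP xy]; first by rewrite leey.
by rewrite lee_fin; have := log_partial_le h0 L r01 xs ys xy; lra.
Qed.

(** All squared moments but one are dropped, their weights being nonnegative; then L tends to
    infinity at fixed r, and finally r tends to 1. *)
Lemma log_energy_ge (k : nat) :
  ((- ln (h / 2) + 2 / k.+1%:R * (\int[nu]_z clip_tau m h k z) ^+ 2)%:E <= log_energy nu)%E.
Proof.
set T := \int[nu]_z _.
have H r L : 0 < r < 1 -> (k < L)%N ->
   ((- ln (h / 2) + 2 * r ^+ k.+1 / k.+1%:R * T ^+ 2 +
     (ln r - 2 * (r ^+ L.+1 / (1 - r))))%:E <= log_energy nu)%E.
  move=> r01 kL; have /andP[r0 r1] := r01.
  apply: le_trans (log_energy_ge_trunc L r01); rewrite lee_fin lerD2r lerD2l.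
  rewrite [leRHS](bigD1 (Ordinal kL))//= lerDl.
  apply: sumr_ge0 => j _; apply: mulr_ge0; last exact: sqr_ge0.
  by rewrite divr_ge0// mulr_ge0// exprn_ge0// ltW.
case EI : (log_energy nu) H => [i| |] H; [|by rewrite leey|]; last first.
  (* An energy equal to -oo would contradict the finite lower bound at r = 1/2. *)
  pose q : R := 2^-1; have half01 : 0 < q < 1 by rewrite /q; lra.
  by have := H q k.+1 half01 (ltnSn k); rewrite leeNy_eq.
rewrite lee_fin.
have H2 r : 0 < r < 1 -> - ln (h / 2) + 2 * r ^+ k.+1 / k.+1%:R * T ^+ 2 + ln r <= i.
  move=> r01; have /andP[r0 r1] := r01.
  apply: (@le_of_geometric _ _ _ (2 * (r / (1 - r))) r k.+1); first by rewrite ltW.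
  move=> L kL; have := H r L r01 kL; rewrite lee_fin [r ^+ L.+1]exprS.
  have -> : 2 * (r / (1 - r)) * r ^+ L = 2 * (r * r ^+ L / (1 - r)).
    by rewrite -!mulrA [_^-1 * _]mulrC.
  by move: (2 * (_ / _)) => e; rewrite addrA lerBlDr.
pose f r := - ln (h / 2) + 2 * r ^+ k.+1 / k.+1%:R * T ^+ 2 + ln r.
have cf : f r @[r --> (1 : R)^'-] --> f 1.
  apply: cvg_at_left_filter; apply: cvgD; last by apply: continuous_ln; exact: ltr01.
  apply: cvgD; first exact: cvg_cst.
  apply: cvgM; last exact: cvg_cst.
  apply: cvgM; last exact: cvg_cst.
  apply: cvgM; first exact: cvg_cst.
  have cX : continuous (fun x : R => x ^+ k.+1) by exact: exprn_continuous.
  exact: cX.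
have -> : - ln (h / 2) + 2 / k.+1%:R * T ^+ 2 = f 1.
  by rewrite /f ln1 addr0 expr1n mulr1.
apply: (cvgr_to_le cf); near=> r; apply: H2; apply/andP; split; near: r.
  exact: nbhs_left_gt.
exact: nbhs_left_lt.
Unshelve. all: by end_near. Qed.

End EnergyLower.

(** * The arcsine distribution and its Chebyshev moments *)

Section Arcsine.
Context (R : realType) (m h : R).
Hypothesis h0 : 0 < h.
Let E := real_in_plane (seg m h).

Lemma deMoivre (x : R) k :
  ((cos x +i* sin x) ^+ k : R[i]) = cos (k%:R * x) +i* sin (k%:R * x).
Proof.
elim: k => [|k IH]; first by rewrite expr0 mul0r cos0 sin0.
rewrite exprS IH -natr1 mulrDl mul1r cosD sinD.
by simpc; congr (_ +i* _); ring.
Qed.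

Lemma tau_cos k (x : R) : tau m h k (m + h * cos x) = cos (k%:R * x).
Proof.
have w1 : cabs (cos x +i* sin x) = 1.
  by apply/eqP; rewrite -(@pexpr_eq1 _ _ 2)// ?cabs_ge0// cabs_sqr /= cos2Dsin2.
by have := tau_unit m h0 k w1; rewrite deMoivre.
Qed.

(** The image of the uniform law on [0, 1] under this curve is the arcsine law; its Chebyshev
    moments become integrals of cos (k pi t). *)
Definition arc (t : measurableTypeR R) : (R * R)%type := (m + h * cos (pi * t), 0).

Lemma measurable_arc : measurable_fun [set: measurableTypeR R] arc.
Proof.
apply: measurable_fun_pair => //=.
apply: continuous_measurable_fun => t; apply: cvgD; first exact: cvg_cst.
apply: cvgM; first exact: cvg_cst.
apply: continuous_comp; last exact: continuous_cos.
by apply: cvgM; [exact: cvg_cst|exact: cvg_id].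
Qed.

HB.instance Definition _ :=
  isMeasurableFun.Build _ _ (measurableTypeR R) (R * R)%type arc measurable_arc.

Let P0 : probability _ R := uniform_prob (@ltr01 R).

Definition arcsine : probability (R * R)%type R := distribution P0 arc.

Lemma arc_real_in_plane t : E (arc t).
Proof.
split => //; rewrite /seg /=; have := cos_max (pi * t).
rewrite ler_norml => /andP[c1 c2].
by rewrite !lerD2l -{1}mulrN1 !ler_pM2l// -[X in _ && (_ <= X)]mulr1 ler_pM2l// c1 c2.
Qed.

Lemma arcsine_real_in_plane : arcsine E = 1%E.
Proof.
rewrite /arcsine /distribution /pushforward /= (_ : arc @^-1` E = setT).
  exact: probability_setT.
by apply/seteqP; split => // t _; exact: arc_real_in_plane.
Qed.

Let clip_tau_arc k t : clip_tau m h k (arc t) = cos (k.+1%:R * (pi * t)).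
Proof. by rewrite clip_tauE ?tau_cos//; exact: arc_real_in_plane. Qed.

Lemma sin_natpi (k : nat) : sin (k%:R * pi : R) = 0.
Proof.
elim: k => [|k IH]; first by rewrite mul0r sin0.
by rewrite -natr1 mulrDl mul1r sinDpi IH oppr0.
Qed.

(** The summand 1 keeps the integrand nonnegative, as is required when an integral for the uniform
    law is turned into a Lebesgue integral. *)
Lemma integral_oneDcos (c : R) : c != 0 -> sin c = 0 ->
  (\int[lebesgue_measure]_(t in `[0%R, 1%R]) (1 + cos (c * t))%:E = 1)%E.
Proof.
move=> c0 sc.
pose F (t : R) := t + c^-1 * sin (c * t).
have dF (t : R) : is_derive t (1 : R) F (1 + cos (c * t)).
  have h1 := is_deriveZ c (is_derive_id t (1 : R)).
  have h2 := is_derive1_comp (is_derive_sin (c * t)) h1.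
  have h3 := is_deriveD (is_derive_id t (1 : R)) (is_deriveZ c^-1 h2).
  apply: is_derive_eq h3 _.
  by rewrite /GRing.scale /= mulr1 mulrCA mulVf// mulr1.
rewrite (@continuous_FTC2 _ _ F) ?ltr01//.
- by rewrite /F mulr1 sc mulr0 addr0 mulr0 sin0 mulr0 addr0 sube0.
- apply: continuous_subspaceT => t; apply: cvgD; first exact: cvg_cst.
  apply: continuous_comp; last exact: continuous_cos.
  by apply: cvgM; [exact: cvg_cst|exact: cvg_id].
- have cF : continuous F.
    by move=> t; apply: differentiable_continuous; apply/derivable1_diffP; have [] := dF t.
  split.
  + by move=> t _; have [] := dF t.
  + exact: cvg_at_right_filter (cF 0).
  + exact: cvg_at_left_filter (cF 1).
- by move=> t _; rewrite derive1E; have [_ ->] := dF t.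
Qed.

Lemma integral_arcsine_tau k : \int[arcsine]_z clip_tau m h k z = 0.
Proof.
have mt : measurable_fun setT (clip_tau m h k) by exact: measurable_clip_tau.
have mc : measurable_fun [set: measurableTypeR R] (clip_tau m h k \o arc).
  exact: measurableT_comp mt measurable_arc.
have ct1 t : `|(clip_tau m h k \o arc) t| <= 1 by exact: clip_tau_le1.
have ic : P0.-integrable setT (EFin \o (clip_tau m h k \o arc)).
  exact: bounded_prob_integrable mc ct1.
have ik : P0.-integrable setT (EFin \o (fun=> (1 : R))).
  by apply: (@bounded_prob_integrable _ _ _ P0 _ `|1|).
have -> : \int[arcsine]_z clip_tau m h k z = \int[P0]_t (clip_tau m h k \o arc) t.
  rewrite /Rintegral; congr fine.
  rewrite /arcsine (@integral_distribution _ _ _ _ _ P0 arc (EFin \o clip_tau m h k))//.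
  exact/measurable_EFinP.
have E1 : (\int[P0]_t (1 + (clip_tau m h k \o arc) t)%:E = 1)%E.
  rewrite integral_uniform//.
  - rewrite subr0 invr1 mul1e -(@integral_oneDcos (k.+1%:R * pi)).
    + by apply: eq_integral => t _; rewrite /= clip_tau_arc mulrA.
    + by rewrite mulf_neq0 ?pnatr_eq0// gt_eqF// pi_gt0.
    + exact: sin_natpi.
  - by apply/measurable_EFinP; apply: measurable_funD.
  - by move=> t; rewrite lee_fin; have := ct1 t; rewrite ler_norml => /andP[? _]; lra.
have : (\int[P0]_t (1 + (clip_tau m h k \o arc) t)%:E)%E = (1 + \int[P0]_t (clip_tau m h k \o arc) t)%:E.
  rewrite (eq_integral (fun t => (1%:E + ((clip_tau m h k \o arc) t)%:E)%E)) => [|t _]; last by rewrite EFinD.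
  rewrite integralD// EFinD -EFin_Rintegral//; congr (_ + _)%E.
  by rewrite integral_cst//= probability_setT mule1.
by rewrite E1 => -[] /eqP; rewrite eq_sym addrC -subr_eq0 addrK => /eqP.
Qed.

End Arcsine.

(** * Energy of the arcsine distribution *)

Section ArcsineEnergy.
Context (R : realType) (m h : R).
Hypothesis h0 : 0 < h.
Let E := real_in_plane (seg m h).
Let om := arcsine m h.
Let oo : probability _ R := (om \x om)%E.
Let omE : om E = 1%E. Proof. exact: arcsine_real_in_plane. Qed.
Let dist (zw : (R * R) * (R * R)) : R :=
  cabs (complex_of_plane zw.1 - complex_of_plane zw.2).
Let mdist : measurable_fun setT dist .
Proof. exact: measurable_plane_dist. Qed.

Let mEE : measurable (E `*` E).
Proof. by apply: measurableX; exact: measurable_real_in_plane. Qed.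

Let mreg (eta c : R) : measurable_fun setT (fun zw => (- ln (dist zw + eta) + c)%:E).
Proof.
apply/measurable_EFinP; apply: measurable_funD => //; apply: measurable_funN.
apply: (@measurableT_comp _ _ _ _ _ _ (@ln R)); first exact: measurable_ln.
exact: measurable_funD.
Qed.

Let distE x y : dist ((x, 0), (y, 0)) = `|x - y|.
Proof. by rewrite /dist plane_dist /= subrr expr0n addr0 sqrtr_sqr. Qed.

(** The moments of the arcsine law vanish, so the bound of [log_partial_ge] integrates to - ln (h/2)
    plus a remainder that tends to 0 with growing L. The constant c leaves room for a shift that
    makes the kernel nonnegative. *)
Lemma arcsine_reg_le (eta c : R) : 0 < eta ->
  (\int[oo]_(zw in E `*` E) (- ln (dist zw + eta) + c)%:E <= (- ln (h / 2) + c)%:E)%E.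
Proof.
move=> eta0; have h52 : 0 < 5 * (h / 2) by rewrite !mulr_gt0 ?invr_gt0.
(* s = 1 - r: the second bound meets the condition of [log_partial_ge], the first keeps r
   positive. *)
pose s := Num.min 2^-1 (eta / (5 * (h / 2))).
pose r := 1 - s.
have s0 : 0 < s by rewrite lt_min divr_gt0 ?invr_gt0 ?andbT.
have s1 : s <= 2^-1 by rewrite ge_min lexx.
have s2 : s <= eta / (5 * (h / 2)) by rewrite ge_min lexx orbT.
have r01 : 0 < r < 1 by rewrite /r; lra.
have re : 5 * (h / 2) * (1 - r) <= eta.
  by rewrite /r subKr mulrC -ler_pdivlMr.
have H L : (\int[oo]_(zw in E `*` E) (- ln (dist zw + eta) + c)%:E <=
    (- ln (h / 2) + c + 2 * (r / (1 - r)) * r ^+ L)%:E)%E.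
  have := integral_clip_log_on h0 omE r L (c + 2 * (r / (1 - r)) * r ^+ L).
  rewrite big1 ?addr0 ?addrA => [<-|k _]; last first.
    by rewrite integral_arcsine_tau// expr0n mulr0.
  apply: le_integral_measurable => //.
  - by apply: measurable_funTS; exact: mreg.
  - apply: measurable_funTS; apply/measurable_EFinP; apply: measurable_funD => //.
    exact: measurable_clip_log.
  move=> [[x x2] [y y2]] EE; rewrite clip_logE// lee_fin.
  case: EE => -[/= xs x20] [/= ys y20]; rewrite x20 y20 distE.
  have := log_partial_ge h0 L r01 xs ys re; rewrite [r ^+ L.+1]exprS.
  have -> : 2 * (r / (1 - r)) * r ^+ L = 2 * (r * r ^+ L / (1 - r)).
    by rewrite -!mulrA [_^-1 * _]mulrC.
  by move=> H; rewrite [leRHS]addrCA [leRHS]addrC lerD2r.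
case EI : (\int[oo]_(zw in E `*` E) (- ln (dist zw + eta) + c)%:E)%E H => [i| |] H.
- rewrite lee_fin; apply: (@le_of_geometric _ _ _ (2 * (r / (1 - r))) r 0%N).
    by case/andP: r01 => a b; rewrite ltW.
  by move=> L _; have := H L; rewrite lee_fin.
- by have := H 0; rewrite leye_eq.
- by rewrite leNye.
Qed.

(** Fatou's lemma along eta = 1/(l+1), applied to the regularized kernels shifted by K. *)
Lemma arcsine_log_energy_le : (log_energy om <= (- ln (h / 2))%:E)%E.
Proof.
have h2 : 0 < 2 * h + 1 by rewrite addr_gt0// mulr_gt0.
(* Distances in the segment are at most 2h and eta is at most 1, so the shift by K makes the
   regularized kernels nonnegative. *)
pose K := ln (2 * h + 1).
pose f (l : nat) zw := (- ln (dist zw + l.+1%:R^-1) + K)%:E.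
have dEE zw : (E `*` E) zw -> 0 <= dist zw <= 2 * h.
  case: zw => [[x x2] [y y2]] [[/= xs x20] [/= ys y20]].
  rewrite x20 y20 distE normr_ge0 ler_norml.
  by move: xs ys; rewrite /seg /= => /andP[? ?] /andP[? ?]; lra.
have f0 l zw : (E `*` E) zw -> (0 <= f l zw)%E.
  move=> /dEE /andP[d0 d1]; have l0 : 0 < l.+1%:R^-1 :> R by rewrite invr_gt0.
  have l1 : l.+1%:R^-1 <= 1 :> R by rewrite invf_le1// ler1n.
  rewrite lee_fin addrC subr_ge0 ler_ln ?posrE ?lerD//.
  by rewrite ltr_wpDl.
have mf l : measurable_fun setT (f l) by exact: mreg.
have fl l : (\int[oo]_(zw in E `*` E) f l zw <= (- ln (h / 2) + K)%:E)%E.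
  by apply: arcsine_reg_le; rewrite invr_gt0.
have lim zw : (E `*` E) zw -> limn_einf (f^~ zw) = (log_kernel zw + K%:E)%E.
  move=> zwE; rewrite (_ : log_kernel zw = if dist zw == 0 then +oo%E else (- ln (dist zw))%:E).
    have [d0|d0] := eqVneq (dist zw) 0.
      rewrite addye//; apply: (cvg_limn_einf_sup _).1; apply/cvgeryP.
      apply/cvgryPge => B; near=> l.
      rewrite d0 add0r lnV ?posrE// opprK -lerBlDr -[leLHS]expRK ler_ln ?posrE ?expR_gt0//.
      apply: (@le_trans _ _ l%:R); last by rewrite ler_nat.
      near: l; exact: nbhs_infty_ger.
    apply: (cvg_limn_einf_sup _).1; rewrite -EFinD; apply: cvg_EFin.
      by near=> l.
    apply: cvgD; last exact: cvg_cst.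
    have dp : 0 < dist zw by rewrite lt_def d0 /=; exact: cabs_ge0.
    have cd : (fun l : nat => dist zw + l.+1%:R^-1) @ \oo --> dist zw.
      rewrite -[X in _ --> X]addr0; apply: cvgD; first exact: cvg_cst.
      exact: cvg_harmonic.
    apply: cvgN; exact: (cvg_comp _ _ cd (continuous_ln dp)).
  by rewrite log_kernelE.
have le1 : (\int[oo]_(zw in E `*` E) (log_kernel zw + K%:E) <= (- ln (h / 2) + K)%:E)%E.
  rewrite (eq_integral (fun zw => limn_einf (f^~ zw))); last first.
    by move=> zw; rewrite inE => zwE; rewrite lim.
  apply: le_trans (fatou _ mEE _ f0) _; first by move=> l; apply: measurable_funTS.
  rewrite limn_einf_lim; apply: lime_le; first exact: is_cvg_einfs.
  near=> l; apply: le_trans (fl l); apply: ereal_inf_lbound; exists l => //=.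
have mlk : measurable_fun (E `*` E) (fun zw => log_kernel zw + K%:E)%E.
  apply: emeasurable_funD => //; apply: measurable_funTS; exact: measurable_log_kernel.
have lk0 zw : (E `*` E) zw -> (0 <= log_kernel zw + K%:E)%E.
  move=> zwE; rewrite -lim// limn_einf_lim; apply: lime_ge; first exact: is_cvg_einfs.
  by near=> l; apply/ereal_infP => _ [k _ <-]; exact: f0.
have oE : oo (E `*` E) = 1%E.
  rewrite /oo /= product_measure1E; try exact: measurable_real_in_plane.
  by rewrite -[RHS]mule1; congr (_ * _)%E; exact: omE.
(* The bound [le1] makes the shifted kernel integrable, so that K can be split off again. *)
have ilk : oo.-integrable (E `*` E) (fun zw => log_kernel zw + K%:E)%E.
  apply/integrableP; split => //.
  rewrite (eq_integral (fun zw => log_kernel zw + K%:E)%E); last first.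
    by move=> zw; rewrite inE => zwE; rewrite gee0_abs// lk0.
  exact: le_lt_trans le1 (ltry _).
have iK : oo.-integrable (E `*` E) (fun=> (- K)%:E).
  by apply: finite_measure_integrable_cst.
have -> : log_energy om = (\int[oo]_(zw in E `*` E) ((log_kernel zw + K%:E) + (- K)%:E))%E.
  rewrite /log_energy (@integral_conull _ _ _ oo _ _ mEE)//.
  - by apply: eq_integral => zw _; rewrite EFinN addeK.
  - exact: measurable_log_kernel.
  - exact: prod_conull.
have IK : (\int[oo]_(zw in E `*` E) (- K)%:E = (- K)%:E)%E.
  by rewrite integral_cst// -[RHS]mule1; congr (_ * _)%E; exact: oE.
by rewrite integralD// IK EFinN leeBlDr// -EFinD.
Unshelve. all: by end_near. Qed.

End ArcsineEnergy.

(** * Capacity and equilibrium measure of a segment *)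

Section EquilibriumSegment.
Context (R : realType) (m h : R).
Hypothesis h0 : 0 < h.
Let E := real_in_plane (seg m h).

Let log_energy_lb nu : prob_on E nu -> ((- ln (h / 2))%:E <= log_energy nu)%E.
Proof.
move=> nuE; apply: le_trans (log_energy_ge h0 nuE 0); rewrite lee_fin lerDl.
by rewrite mulr_ge0 ?sqr_ge0 ?divr_ge0.
Qed.

Lemma cap_seg : cap E = h / 2.
Proof.
rewrite /cap (_ : ereal_inf _ = (- ln (h / 2))%:E).
  by rewrite -EFinN opprK /= lnK// posrE divr_gt0.
apply/eqP; rewrite eq_le; apply/andP; split.
  apply: (@le_trans _ _ (log_energy (arcsine m h))); last exact: arcsine_log_energy_le.
  apply: ereal_inf_lbound; exists (arcsine m h) => //.
  exact: arcsine_real_in_plane.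
by apply/ereal_infP => _ [nu nuE <-]; exact: log_energy_lb.
Qed.

(** The arcsine law attains the lower bound, so a minimizer exists and [xget] does not return its
    default. *)
Lemma equilibrium_measureP : is_equilibrium E (equilibrium_measure E).
Proof.
rewrite /equilibrium_measure; case: xgetP => // /(_ (arcsine m h)) [].
split; first exact: arcsine_real_in_plane.
move=> nu nuE; apply: le_trans (log_energy_lb nuE).
exact: (arcsine_log_energy_le m h0).
Qed.

(** A minimizer has energy at most - ln (h/2), which leaves no room for a positive square in
    [log_energy_ge]. *)
Lemma equilibrium_tau k : \int[equilibrium_measure E]_z clip_tau m h k z = 0.
Proof.
have [nuE /(_ (arcsine m h))] := equilibrium_measureP.
move=> /(_ (arcsine_real_in_plane m h0)) le1.
have := le_trans (log_energy_ge h0 nuE k) (le_trans le1 (arcsine_log_energy_le m h0)).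
rewrite lee_fin -lerBrDl subrr pmulr_rle0 ?divr_gt0// => le0.
apply/eqP; rewrite -sqrf_eq0 eq_le le0 sqr_ge0//.
Qed.

End EquilibriumSegment.

(** * Weak convergence of zeros *)

Section UniformContinuity.
Context (R : realType).

(** Only x is confined to K: the point z may leave it, as zeros near the segment do. *)
Lemma compact_unif_continuous (T : pseudoMetricType R) (K : set T) (f : T -> R) :
  compact K -> continuous f -> forall e, 0 < e ->
  exists2 d, 0 < d & forall x z, K x -> ball x d z -> `|f z - f x| <= e.
Proof.
move=> /compact_near_coveringP cK cf e e0.
have e20 : 0 < e / 2 by rewrite divr_gt0.
have := cK R (0 : R)^'+ (fun d x => forall z, ball x d z -> `|f z - f x| <= e) _.
case.
  move=> x Kx.
  have /cvgr_dist_le/(_ _ e20) := cf x.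
  rewrite near_map => /nbhs_ballP[d /= d0 Hd].
  have d20 : 0 < d / 2 by rewrite divr_gt0.
  near=> x' d' => z xz.
  have xx' : ball x (d / 2) x' by near: x'; exact: nbhsx_ballx.
  have d'd : d' <= d / 2 by near: d'; exact: nbhs_right_le.
  have h1 : `|f x - f x'| <= e / 2.
    by apply: Hd; apply: le_ball xx'; rewrite ler_pdivrMr// ler_peMr ?ler1n// ltW.
  have h2 : `|f x - f z| <= e / 2.
    apply: Hd; have -> : d = d / 2 + d / 2 by field.
    by apply: ball_triangle xx' _; exact: le_ball xz.
  have -> : f z - f x' = (f x - f x') - (f x - f z) by ring.
  by rewrite (le_trans (ler_normB _ _))// [leRHS](splitr e) lerD.
move=> d /= d0 Hd; exists (d / 2); first by rewrite divr_gt0.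
move=> x z Kx; apply: Hd => //=; last by rewrite divr_gt0.
by rewrite sub0r normrN gtr0_norm ?divr_gt0// ltr_pdivrMr// ltr_pMr// ltr1n.
Unshelve. all: by end_near. Qed.

End UniformContinuity.

(** * Bernstein polynomials and Weierstrass approximation *)

Section Bernstein.
Context (R : realType).
Implicit Types (phi psi : nat -> R) (t c : R).

(* The Bernstein polynomial sum_k C(n,k) phi(k) X^k (1 - X)^(n-k). *)
Fixpoint bernstein n phi : {poly R} :=
  if n is n'.+1 then
    'X * bernstein n' (fun k => phi k.+1) + (1 - 'X) * bernstein n' phi
  else (phi 0%N)%:P.

Lemma bernsteinS n phi t : (bernstein n.+1 phi).[t] =
  t * (bernstein n (fun k => phi k.+1)).[t] + (1 - t) * (bernstein n phi).[t].
Proof. by rewrite /= !hornerE. Qed.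

Lemma bernstein_cst n c t : (bernstein n (fun=> c)).[t] = c.
Proof. by elim: n => [|n IH]; rewrite ?bernsteinS ?IH ?hornerC//; ring. Qed.

Lemma bernstein_lin n phi psi c t :
  (bernstein n (fun k => phi k + c * psi k)).[t] =
  (bernstein n phi).[t] + c * (bernstein n psi).[t].
Proof.
elim: n phi psi => [|n IH] phi psi; first by rewrite /= !hornerC.
have IH1 := IH (fun k => phi k.+1) (fun k => psi k.+1).
by rewrite !bernsteinS IH1 IH; ring.
Qed.

Lemma bernstein_le n phi psi t : 0 <= t <= 1 ->
  (forall k, (k <= n)%N -> phi k <= psi k) ->
  (bernstein n phi).[t] <= (bernstein n psi).[t].
Proof.
move=> /andP[t0 t1]; elim: n phi psi => [|n IH] phi psi H.
  by rewrite /= !hornerC H.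
rewrite !bernsteinS lerD// ler_wpM2l ?subr_ge0//; apply: IH => k kn; apply: H => //.
exact: leqW.
Qed.

(** Second moment about c of a binomial variable: squared bias plus the variance n t (1 - t). *)
Lemma bernstein_sqr n c t : (bernstein n (fun k => (k%:R - c) ^+ 2)).[t] =
  (n%:R * t - c) ^+ 2 + n%:R * t * (1 - t).
Proof.
elim: n c => [|n IH] c; first by rewrite /= hornerC; ring.
rewrite bernsteinS IH.
have -> : (bernstein n (fun k => (k.+1%:R - c) ^+ 2)).[t] =
          (bernstein n (fun k => (k%:R - (c - 1)) ^+ 2)).[t].
  by congr (bernstein n _).[t]; apply/funext => k; rewrite -natr1; ring.
by rewrite IH -natr1; ring.
Qed.

(** Bernstein's proof: uniform continuity at close points and boundedness at distant ones give |g x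
    - g t| <= e/2 + K (x - t)^2, and averaging over the nodes turns the square into a variance of
    order 1/n. *)
Lemma weierstrass01 (g : R -> R) : continuous g -> forall e, 0 < e ->
  exists p : {poly R}, forall t, 0 <= t <= 1 -> `|g t - p.[t]| <= e.
Proof.
move=> cg e e0; have e20 : 0 < e / 2 by rewrite divr_gt0.
have [d d0 Hd] := compact_unif_continuous (@segment_compact R 0 1) cg e20.
have [M HM] : exists M, forall t, 0 <= t <= 1 -> `|g t| <= M.
  have /compact_bounded[M0 [_ HM]] : compact (g @` `[0, 1]%classic).
    apply: continuous_compact; last exact: segment_compact.
    exact: continuous_subspaceT.
  exists (M0 + 1) => t t01; apply: (HM (M0 + 1)); first by rewrite ltrDl.
  by exists t => //=; rewrite in_itv.
have M0 : 0 <= M by apply: le_trans (HM 0 _); rewrite ?lexx ?ler01.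
(* Makes K (x - t)^2 >= 2 M as soon as |x - t| >= d. *)
pose K := 2 * M / d ^+ 2.
have K0 : 0 <= K by rewrite divr_ge0 ?mulr_ge0 ?exprn_ge0// ltW.
have key x t : 0 <= x <= 1 -> 0 <= t <= 1 -> `|g x - g t| <= e / 2 + K * (x - t) ^+ 2.
  move=> x01 t01; have [xt|xt] := ltP `|x - t| d.
    apply: (@le_trans _ _ (e / 2)); last by rewrite lerDl mulr_ge0 ?sqr_ge0.
    apply: Hd; first by rewrite /= in_itv.
    by rewrite -ball_normE /= distrC.
  apply: (@le_trans _ _ (K * (x - t) ^+ 2)); last by rewrite lerDr ltW.
  apply: (@le_trans _ _ (2 * M)).
    by rewrite mulr_natl mulr2n (le_trans (ler_normB _ _))// lerD ?HM.
  rewrite /K mulrAC ler_pdivlMr ?exprn_gt0// ler_wpM2l ?mulr_ge0//.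
  by rewrite -[(x - t) ^+ 2]real_normK ?num_real// lerXn2r ?nnegrE ?(ltW d0)// (le_trans (ltW d0)).
pose n := (Num.truncn (K / (e / 2))).+1.
have n0 : 0 < n%:R :> R by rewrite ltr0n.
have nK : K / n%:R <= e / 2.
  rewrite ler_pdivrMr// mulrC -ler_pdivrMr//.
  by rewrite ltW// truncnS_gt.
pose phi (k : nat) := g (k%:R / n%:R).
exists (bernstein n phi) => t t01.
(* [psi 1] and [psi (-1)] bracket [phi] at the nodes, and their Bernstein polynomials are known
   exactly. *)
pose psi s (k : nat) := g t + s * (e / 2 + K / n%:R ^+ 2 * (k%:R - n%:R * t) ^+ 2).
have Epsi s : (bernstein n (psi s)).[t] = g t + s * (e / 2 + K / n%:R * (t * (1 - t))).
  rewrite /psi (bernstein_lin n (fun=> g t)) bernstein_cst.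
  rewrite (bernstein_lin n (fun=> e / 2)) bernstein_cst bernstein_sqr subrr.
  by congr (_ + _ * (_ + _)); field; rewrite gt_eqF.
have t11 : K / n%:R * (t * (1 - t)) <= e / 2.
  have Kn0 : 0 <= K / n%:R by apply: (divr_ge0 K0); exact: ltW.
  apply: le_trans nK; rewrite ler_piMr//.
  by case/andP: t01 => a b; nra.
have kt k : (k <= n)%N -> `|phi k - g t| <= e / 2 + K / n%:R ^+ 2 * (k%:R - n%:R * t) ^+ 2.
  move=> kn; have -> : K / n%:R ^+ 2 * (k%:R - n%:R * t) ^+ 2 = K * (k%:R / n%:R - t) ^+ 2.
    by field; rewrite gt_eqF.
  apply: key => //; rewrite divr_ge0 ?(ltW n0)//= ler_pdivrMr// mul1r ler_nat//.
have up : (bernstein n phi).[t] <= (bernstein n (psi 1)).[t].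
  apply: bernstein_le => // k kn; have := kt k kn; rewrite ler_norml /psi => /andP[_].
  by rewrite mul1r lerBlDl.
have lo : (bernstein n (psi (-1))).[t] <= (bernstein n phi).[t].
  apply: bernstein_le => // k kn; have := kt k kn; rewrite ler_norml /psi => /andP[+ _].
  by rewrite mulN1r lerBrDr addrC.
rewrite !Epsi mul1r mulN1r in up lo.
by rewrite ler_norml; apply/andP; split; lra.
Qed.

Lemma weierstrass (m h : R) (g : R -> R) : 0 < h -> continuous g ->
  forall e, 0 < e -> exists p : {poly R},
  forall x, m - h <= x <= m + h -> `|g x - p.[x]| <= e.
Proof.
move=> h0 cg e e0; pose G t := g (m - h + 2 * h * t).
have cG : continuous G.
  move=> t; apply: (continuous_comp (f := fun t => m - h + 2 * h * t)); last exact: cg.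
  apply: cvgD; first exact: cvg_cst.
  by apply: cvgM; [exact: cvg_cst|exact: cvg_id].
have [p Hp] := weierstrass01 cG e0.
exists (p \Po ((2 * h)^-1 *: ('X - (m - h)%:P))) => x /andP[x0 x1].
have h2 : 0 < 2 * h by rewrite mulr_gt0.
rewrite horner_comp !hornerE.
pose t := (2 * h)^-1 * (x - (m - h)).
have tx : x = m - h + 2 * h * t by rewrite /t mulVKf ?gt_eqF// addrC subrK.
rewrite {1}tx -/t; apply: Hp; rewrite /t mulrC ler_pdivlMr// mul0r ler_pdivrMr//.
by apply/andP; split; lra.
Qed.

End Bernstein.

(** * Measurability in the plane and averages over zeros *)

Section PlaneMeasurability.
Context (R : realType).

(** An open set is the union of the countably many rational boxes that it contains, and these belong
    to the product sigma-algebra. *)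
Lemma open_plane_measurable (U : set (R * R)) : open U -> measurable U.
Proof.
move=> oU.
pose box (i : rat * rat * nat) : set (R * R) :=
  ball (ratr i.1.1 : R) i.2.+1%:R^-1 `*` ball (ratr i.1.2 : R) i.2.+1%:R^-1.
have -> : U = \bigcup_i (if `[< box i `<=` U >] then box i else set0).
  apply/seteqP; split => [z Uz|z [i _]]; last first.
    by case: asboolP => // iU /iU.
  have /nbhs_ballP[e /= e0 eU] := open_nbhs_nbhs (conj oU Uz).
  pose n := (Num.truncn (2 / e)).
  have n0 : 0 < n.+1%:R^-1 :> R by rewrite invr_gt0.
  have ne : n.+1%:R^-1 + n.+1%:R^-1 < e.
    have -> : n.+1%:R^-1 + n.+1%:R^-1 = 2 / n.+1%:R :> R by ring.
    by rewrite ltr_pdivrMr// mulrC -ltr_pdivrMr// truncnS_gt.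
  have rat_near (x : R) : exists q : rat, ball (ratr q : R) n.+1%:R^-1 x.
    have [q] : exists q : rat, ratr q \in `]x, x + n.+1%:R^-1[.
      by apply: rat_in_itvoo; rewrite ltrDl.
    rewrite in_itv /= => /andP[q1 q2]; exists q.
    by rewrite -ball_normE /= gtr0_norm ?subr_gt0// ltrBlDl.
  have [q1 Hq1] := rat_near z.1; have [q2 Hq2] := rat_near z.2.
  exists (q1, q2, n) => //; case: asboolP; first by move=> _; split.
  move=> H; exfalso; apply: H => -[a b] [/= ha hb]; apply: eU.
  split; apply: le_ball (ltW ne) _ _; apply: ball_triangle; try eassumption; exact: ball_sym.
apply: countable_bigcupT_measurable => [|i]; first exact: countableP.
case: ifP => // _; apply: measurableX; exact: measurable_ball.
Qed.

Lemma continuous_plane_measurable (f : R * R -> R) :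
  continuous f -> measurable_fun setT f.
Proof.
move=> /continuousP cf; apply: (measurability _ (RGenOpens.measurableE R)).
move=> _ [_ [a [b ->] <-]]; rewrite setTI.
apply: open_plane_measurable; apply: cf; exact: interval_open.
Qed.

Lemma integral_zero_counting (q : {poly R[i]}) (f : R * R -> R) :
  q != 0 -> measurable_fun setT f ->
  \int[zero_counting q]_z f z =
  ((size q).-1)%:R^-1 * \sum_(z <- zeros q) f (plane_of z).
Proof.
move=> q0 mf.
have ge0_case (g : R * R -> R) : (forall z, 0 <= g z) -> measurable_fun setT g ->
  (\int[zero_counting q]_z (g z)%:E = (((size q).-1)%:R^-1 * \sum_(z <- zeros q) g (plane_of z))%:E)%E.
  move=> g0 mg; have mgE : measurable_fun setT (EFin \o g) by exact/measurable_EFinP.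
  rewrite /zero_counting ge0_integral_mscale//; last by move=> z _; rewrite lee_fin.
  rewrite ge0_integral_measure_sum//; last by move=> z _; rewrite lee_fin.
  rewrite EFinM; congr (_ * _)%E.
  rewrite (big_nth 0) size_zeros// big_mkord -sumEFin; apply: eq_bigr => i _.
  by rewrite integral_dirac// diracT mul1e.
have mp : measurable_fun setT (fun z => Num.max (f z) 0) by exact: measurable_maxr.
have mn : measurable_fun setT (fun z => Num.max (- f z) 0).
  by apply: measurable_maxr => //; exact: measurable_funN.
rewrite /Rintegral integralE.
rewrite (eq_integral (fun z => (Num.max (f z) 0)%:E)) => [|z _]; last first.
  by rewrite funeposE EFin_max.
rewrite [X in (_ - X)%E](eq_integral (fun z => (Num.max (- f z) 0)%:E)) => [|z _]; last first.
  by rewrite funenegE EFin_max EFinN.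
rewrite !ge0_case//; try by move=> z; rewrite le_max lexx orbT.
rewrite -EFinB /= -mulrBr -sumrB; congr (_ * _); apply: eq_bigr => z _.
by case: (leP (f (plane_of z)) 0); case: (leP (- f (plane_of z)) 0); lra.
Qed.

End PlaneMeasurability.

(** * Expansion of polynomials in Chebyshev polynomials *)

Section ChebyshevSpan.
Context (R : realType) (m h : R).
Hypothesis h0 : 0 < h.

Lemma cheb_span n (p : {poly R}) : (size p <= n)%N ->
  exists c : nat -> R, p = \sum_(k < n) c k *: cheb m h k.
Proof.
elim: n p => [|n IH] p.
  rewrite leqn0 size_poly_eq0 => /eqP ->; exists (fun=> 0).
  by rewrite big_ord0.
move=> sp; pose l := (cheb m h n)`_n.
have l0 : l != 0.
  have : lead_coef (cheb m h n) != 0.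
    by rewrite lead_coef_eq0 -size_poly_eq0 size_cheb.
  by rewrite lead_coefE size_cheb.
have [c Hc] : exists c : nat -> R, p - (p`_n / l) *: cheb m h n = \sum_(k < n) c k *: cheb m h k.
  apply: IH; apply/leq_sizeP => j; rewrite leq_eqVlt => /orP[/eqP <-|nj].
    by rewrite coefB coefZ -/l mulfVK// subrr.
  have pj : p`_j = 0 by apply: nth_default; exact: leq_trans sp nj.
  have cj : (cheb m h n)`_j = 0 by apply: nth_default; rewrite size_cheb.
  by rewrite coefB coefZ pj cj mulr0 subr0.
exists (fun k => if k == n then p`_n / l else c k).
rewrite big_ord_recr /= eqxx -[LHS](subrK ((p`_n / l) *: cheb m h n)) Hc; congr (_ + _).
by apply: eq_bigr => k _; rewrite ltn_eqF.
Qed.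

Lemma tau_span (p : {poly R}) n : (size p <= n)%N ->
  exists c : nat -> R, forall x, p.[x] = \sum_(k < n) c k * tau m h k x.
Proof.
move=> /cheb_span[c ->]; exists (fun k => c k * (2 * (h / 2) ^+ k)) => x.
rewrite horner_sum; apply: eq_bigr => k _; rewrite hornerZ /tau; field.
by rewrite gt_eqF// exprn_gt0// divr_gt0.
Qed.

End ChebyshevSpan.

(** * Test functions against the equilibrium measure and against zeros *)

Section TestFunctions.
Context (R : realType) (m h : R).
Hypothesis h0 : 0 < h.
Implicit Types (u : R[i]).
Let E := real_in_plane (seg m h).

Let tau0 x : tau m h 0 x = 1.
Proof. by rewrite /tau /cheb /= hornerC expr0 mulr1 mulfV ?pnatr_eq0. Qed.

Variable f : R * R -> R.
Hypothesis cf : continuous f.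
Hypothesis supp_f : compact (closure [set z | f z != 0]).

Let bounded_f : exists2 M, 0 <= M & forall z, `|f z| <= M.
Proof.
have /compact_bounded[M0 [_ HM]] : compact (f @` closure [set z | f z != 0]).
  apply: continuous_compact => //; exact: continuous_subspaceT.
have M1 : 0 <= `|M0| + 1 by rewrite addr_ge0.
exists (`|M0| + 1) => // z; have [->|fz] := eqVneq (f z) 0; first by rewrite normr0.
apply: (HM (`|M0| + 1)); first by rewrite (le_lt_trans (ler_norm _)) ?ltrDl.
by exists z => //; exact: subset_closure.
Qed.

Lemma compact_real_in_plane : compact E.
Proof.
rewrite /E real_in_plane_prod seg_itv; apply: compact_setX; first exact: segment_compact.
exact: compact_set1.
Qed.

(** The constant coefficient is kept apart because both the equilibrium integral and the averages
    over zeros are compared with it. *)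
Lemma segment_approx e : 0 < e -> exists n (c : nat -> R),
  forall x, seg m h x -> `|f (x, 0) - (c 0%N + \sum_(k < n) c k.+1 * tau m h k.+1 x)| <= e.
Proof.
move=> e0; pose g x := f (x, 0).
have cg : continuous g.
  move=> x; apply: (continuous_comp (f := fun x : R => (x, 0 : R))); last exact: cf.
  exact: (cvg_pair (@cvg_id _ (nbhs x)) (cvg_cst (0 : R))).
have [p Hp] := weierstrass m h0 cg e0.
have [c Hc] := tau_span m h0 (leqnSn (size p)).
exists (size p), c => x xs; have := Hp x xs.
by rewrite Hc big_ord_recl tau0 mulr1.
Qed.

(** The nonconstant Chebyshev moments of the equilibrium measure vanish, so the approximant
    integrates to [c 0]. *)
Lemma equilibrium_integral_approx e n (c : nat -> R) :
  (forall x, seg m h x -> `|f (x, 0) - (c 0%N + \sum_(k < n) c k.+1 * tau m h k.+1 x)| <= e) ->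
  `|\int[equilibrium_measure E]_z f z - c 0%N| <= e.
Proof.
move=> H; set nu := equilibrium_measure E.
have [nuE _] := equilibrium_measureP m h0.
have mf := continuous_plane_measurable cf.
have mE : measurable E by exact: measurable_real_in_plane.
have mt k : measurable_fun setT (clip_tau m h k) by exact: measurable_clip_tau.
pose p z := c 0%N + \sum_(k < n) c k.+1 * clip_tau m h k z.
have mp : measurable_fun setT p.
  by apply: measurable_funD => //; apply: measurable_sum => k; exact: measurable_funM.
have Ip : (\int[nu]_z (p z)%:E = (c 0%N)%:E)%E.
  rewrite (prob_integral_lin nu _ n (fun k => c k.+1) mt); last by move=> k z; exact: clip_tau_le1.
  by rewrite big1 ?addr0// => k _; rewrite equilibrium_tau// mulr0.
have nuC : nu (~` E) = 0%E.
  by rewrite probability_setC// [X in (_ - X)%E](_ : _ = 1%E) ?subee//; exact: nuE.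
have [M M0 HM] := bounded_f.
have iff : nu.-integrable setT (EFin \o f) by exact: bounded_prob_integrable mf HM.
have pM z : `|p z| <= `|c 0%N| + \sum_(k < n) `|c k.+1|.
  rewrite (le_trans (ler_normD _ _))// lerD2l (le_trans (ler_norm_sum _ _ _))//.
  apply: ler_sum => k _; rewrite normrM ler_piMr//.
  exact: clip_tau_le1.
have ip : nu.-integrable setT (EFin \o p) by exact: bounded_prob_integrable mp pM.
have -> : \int[nu]_z f z - c 0%N = \int[nu]_z (f z - p z).
  rewrite RintegralB//; congr (_ - _).
  by rewrite /Rintegral Ip.
have md : measurable_fun setT (fun z => f z - p z) by exact: measurable_funB.
have id : nu.-integrable setT (EFin \o (fun z => f z - p z)).
  apply: (@bounded_prob_integrable _ _ _ nu _ (M + (`|c 0%N| + \sum_(k < n) `|c k.+1|))) => // z.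
  by rewrite (le_trans (ler_normB _ _))// lerD.
rewrite (le_trans (le_normr_Rintegral _ id))//.
rewrite -lee_fin -EFin_Rintegral//; last first.
  apply: (@bounded_prob_integrable _ _ _ nu _ (M + (`|c 0%N| + \sum_(k < n) `|c k.+1|))) => [|z].
    exact: measurableT_comp.
  by rewrite normr_id (le_trans (ler_normB _ _))// lerD.
rewrite (integral_conull mE)//; last by apply/measurable_EFinP; exact: measurableT_comp.
apply: (@le_trans _ _ (\int[nu]_(z in E) e%:E)%E).
  apply: ge0_le_integral => //.
  - by apply: measurable_funTS; apply/measurable_EFinP; exact: measurableT_comp.
  - move=> [x y] zE; rewrite lee_fin; have [xs y0] := zE.
    have := H x xs; rewrite /p; congr (`|f _ - (_ + _)| <= _); first by rewrite /= in y0; rewrite y0.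
    by apply: eq_bigr => k _; rewrite clip_tauE.
rewrite integral_cst// [X in (_ * X)%E](_ : _ = 1%E) ?mule1//; exact: nuE.
Qed.

Lemma ln_inv_ge (s : R) : 0 < s -> 1 - s <= - ln s.
Proof.
move=> s0; have := @le_ln1Dx R (s - 1).
have -> : 1 + (s - 1) = s by ring.
by rewrite lerNr opprB; apply; lra.
Qed.

(* An error tolerance growing like ln (1/|u|) makes the comparison with the
   boundary values hold on the whole disc. *)
Lemma disc_approx e n (c : nat -> R) : 0 < e ->
  (forall x, seg m h x -> `|f (x, 0) - (c 0%N + \sum_(k < n) c k.+1 * tau m h k.+1 x)| <= e) ->
  exists2 C, 0 <= C & forall u, u != 0 -> cabs u <= 1 ->
  `|f (plane_of (joukowski m h u)) -
     (c 0%N + \sum_(k < n) c k.+1 * complex.Re (u ^+ k.+1))| <= 2 * e - C * ln (cabs u).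
Proof.
move=> e0 H.
have [M M0 HM] := bounded_f.
have [d d0 Hd] := compact_unif_continuous compact_real_in_plane cf e0.
pose K := \sum_(k < n) `|c k.+1| * k.+1%:R.
have K0 : 0 <= K by apply: sumr_ge0 => k _; rewrite mulr_ge0.
(* If 1 - |u| <= eta, then |u| >= 1/2, and J u is within d of its companion point on the segment. *)
pose eta := Num.min 2^-1 (d / (4 * h)).
have eta0 : 0 < eta.
  by rewrite lt_min invr_gt0 ltr0n /= divr_gt0// mulr_gt0.
have eta2 : eta <= 2^-1 by rewrite ge_min lexx.
have etad : eta <= d / (4 * h) by rewrite ge_min lexx orbT.
exists (K + 2 * M / eta); first by rewrite addr_ge0 ?divr_ge0 ?mulr_ge0 ?(ltW eta0).
move=> u u0 u1; set s := cabs u.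
have s0 : 0 < s by rewrite cabs_gt0.
have s1 : s <= 1 := u1.
have sC : s%:C != 0 :> R[i] by rewrite fmorph_eq0 gt_eqF.
have ls0 : 0 <= - ln s by rewrite (le_trans _ (ln_inv_ge s0))// subr_ge0.
(* Radial projection of u to the unit circle, where J v lies on the segment. *)
pose v := u / s%:C.
have v1 : cabs v = 1 by rewrite cabsM cabsV cabs_real gtr0_norm// mulfV// gt_eqF.
have uv : u = s%:C * v by rewrite /v mulrC divfK.
clearbody v.
pose x := m + h * complex.Re v.
have xs : seg m h x by exact: joukowski_unit_itv.
have v0 : v != 0 by rewrite -cabs_gt0 v1.
have h1 : `|f (x, 0) - (c 0%N + \sum_(k < n) c k.+1 * complex.Re (v ^+ k.+1))| <= e.
  have := H x xs; congr (`|_ - (_ + _)| <= _); apply: eq_bigr => k _.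
  by rewrite /x tau_unit.
have h2 : `|(c 0%N + \sum_(k < n) c k.+1 * complex.Re (v ^+ k.+1)) -
            (c 0%N + \sum_(k < n) c k.+1 * complex.Re (u ^+ k.+1))| <= K * - ln s.
  rewrite opprD addrACA subrr add0r -sumrB mulr_suml.
  rewrite (le_trans (ler_norm_sum _ _ _))//; apply: ler_sum => k _.
  have rv : `|complex.Re (v ^+ k.+1)| <= 1.
    by rewrite (le_trans (normr_Re _))// cabsX v1 expr1n.
  have sk : 1 - s ^+ k.+1 <= k.+1%:R * - ln s.
    by rewrite (le_trans (ln_inv_ge _)) ?exprn_gt0// lnXn// mulrN mulr_natl.
  have -> : u ^+ k.+1 = (s ^+ k.+1)%:C * v ^+ k.+1 by rewrite {1}uv exprMn rmorphXn.
  rewrite ReZ -mulrBr -{1}[complex.Re _]mul1r -mulrBl.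
  rewrite !normrM -mulrA ler_wpM2l// [`|1 - _|]ger0_norm; last first.
    by rewrite subr_ge0 exprn_ile1// ltW.
  by rewrite -[leRHS]mulr1 ler_pM// subr_ge0 exprn_ile1// ltW.
have h3 : `|f (plane_of (joukowski m h u)) - f (x, 0)| <= e + (2 * M / eta) * - ln s.
  (* Away from the circle the crude bound 2 M is absorbed by the logarithm, as - ln s >= 1 - s >
     eta. *)
  have [se|se] := leP (1 - s) eta; last first.
    apply: (@le_trans _ _ (2 * M / eta * - ln s)); last by rewrite lerDr ltW.
    apply: (@le_trans _ _ (2 * M)).
      by rewrite mulr_natl mulr2n (le_trans (ler_normB _ _))// lerD.
    rewrite mulrAC ler_pdivlMr// ler_wpM2l ?mulr_ge0//.
    exact: le_trans (ltW se) (ln_inv_ge s0).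
  apply: (@le_trans _ _ e); last by rewrite lerDl mulr_ge0 ?divr_ge0 ?mulr_ge0 ?(ltW eta0).
  apply: Hd; first by split.
  have dist : cabs (joukowski m h u - x%:C) < d.
    have -> : joukowski m h u - x%:C = (h / 2)%:C * ((s - 1)%:C * v + (s^-1 - 1)%:C * v^-1).
      rewrite -joukowski_unit// /joukowski uv !rmorphB /= rmorph1 fmorphV; field.
      by rewrite sC v0.
    rewrite cabsM cabs_real ger0_norm ?divr_ge0 ?(ltW h0)//.
    apply: (@le_lt_trans _ _ (h / 2 * ((1 - s) + (s^-1 - 1)))).
      rewrite ler_wpM2l ?divr_ge0 ?(ltW h0)// (le_trans (cabsD _ _))//.
      rewrite !cabsM cabsV v1 invr1 !mulr1 !cabs_real distrC ger0_norm ?subr_ge0//.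
      by rewrite ger0_norm// subr_ge0 invf_ge1.
    have hd : h * (1 - s) <= d / 4.
      by have := le_trans se etad; rewrite ler_pdivlMr ?mulr_gt0//; lra.
    have sV : s^-1 - 1 <= 2 * (1 - s).
      have -> : s^-1 - 1 = (1 - s) / s by field; rewrite gt_eqF.
      by rewrite ler_pdivrMr//; nra.
    have : h / 2 * (1 - s + (s^-1 - 1)) <= h / 2 * (3 * (1 - s)).
      by rewrite ler_wpM2l ?divr_ge0 ?(ltW h0)//; lra.
    by lra.
  have dRe := normr_Re (joukowski m h u - x%:C).
  have dIm := normr_Im (joukowski m h u - x%:C).
  split; rewrite -ball_normE /= distrC.
    apply: le_lt_trans dist; apply: le_trans dRe.
    by case: (joukowski m h u) => a b /=.
  apply: le_lt_trans dist; apply: le_trans dIm.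
  by case: (joukowski m h u) => a b /=.
have -> : f (plane_of (joukowski m h u)) - (c 0%N + \sum_(k < n) c k.+1 * complex.Re (u ^+ k.+1))
  = (f (plane_of (joukowski m h u)) - f (x, 0)) +
    (f (x, 0) - (c 0%N + \sum_(k < n) c k.+1 * complex.Re (v ^+ k.+1))) +
    ((c 0%N + \sum_(k < n) c k.+1 * complex.Re (v ^+ k.+1)) -
            (c 0%N + \sum_(k < n) c k.+1 * complex.Re (u ^+ k.+1))).
  by ring.
apply: le_trans (ler_normD _ _) _; apply: le_trans (lerD (ler_normD _ _) (lexx _)) _.
apply: le_trans (lerD (lerD h3 h1) h2) _.
by rewrite mulrDl; lra.
Qed.

(** Logarithm of the excess of B over the least possible norm (h/2)^d, with the factor 2d + 1 coming
    from [horner_le_size]. *)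
Definition discrepancy (d : nat) (B : R) := ln ((d.*2.+1)%:R * (B / (h / 2) ^+ d)).

(** The approximation is summed over the zeros J u. Jensen's inequality bounds the logarithmic error
    terms, [zero_power_sum_le] the Chebyshev terms, both by multiples of the discrepancy. *)
Lemma zero_average (q : {poly R[i]}) (B e C : R) n (c : nat -> R) :
  q != 0 -> (0 < (size q).-1)%N ->
  (forall x, seg m h x -> cabs q.[x%:C] <= cabs (lead_coef q) * B) ->
  0 <= C ->
  (forall u, u != 0 -> cabs u <= 1 ->
  `|f (plane_of (joukowski m h u)) -
     (c 0%N + \sum_(k < n) c k.+1 * complex.Re (u ^+ k.+1))| <= 2 * e - C * ln (cabs u)) ->
  `|\int[zero_counting q]_z f z - c 0%N| <=
    2 * e + (C + \sum_(k < n) `|c k.+1| * k.+1%:R) *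
      (discrepancy (size q).-1 B / ((size q).-1)%:R).
Proof.
move=> q0 d0 qB C0 H; set d := (size q).-1.
have dR : 0 < d%:R :> R by rewrite ltr0n.
have [us [us0 us1 Ez]] := zeros_joukowski m h0 q.
have sz : size us = d by rewrite /d -size_zeros// Ez size_map.
have Eq := zerosP q; rewrite Ez big_map in Eq.
have lq : 0 < cabs (lead_coef q) by rewrite cabs_gt0 lead_coef_eq0.
have qB' x : m - h <= x <= m + h ->
    cabs (\prod_(u <- us) ('X - (joukowski m h u)%:P)).[x%:C] <= B.
  move=> xs; rewrite -(ler_pM2l lq) -cabsM -hornerZ -Eq; exact: qB.
have dB k : (0 < k)%N -> `|\sum_(u <- us) complex.Re (u ^+ k)| <= k%:R * discrepancy d B.
  by move=> k0; rewrite /discrepancy -sz; exact: (zero_power_sum_le h0 us0 qB' us1).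
have h20 : 0 < (h / 2) ^+ d by rewrite exprn_gt0// divr_gt0.
have dln : - \sum_(u <- us) ln (cabs u) <= discrepancy d B.
  have P0 : 0 < \prod_(u <- us) cabs u.
    by apply: prodr_seq_gt0 => u /us0 u0; rewrite cabs_gt0.
  rewrite -ln_prod; last by move=> u /us0 u0; rewrite cabs_gt0.
  have := prod_cabs_ge h0 us0 qB'; rewrite sz => hB.
  have B0 : 0 < B.
    by have := lt_le_trans h20 hB; rewrite pmulr_lgt0.
  rewrite -lnV ?posrE// /discrepancy ler_ln ?posrE ?invr_gt0 ?mulr_gt0 ?divr_gt0 ?invr_gt0//.
  apply: (@le_trans _ _ (B / (h / 2) ^+ d)).
    by rewrite ler_pdivlMr// mulrC ler_pdivrMr.
  by rewrite ler_peMl ?divr_ge0 ?(ltW h20) ?(ltW B0)// ler1n.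
rewrite integral_zero_counting//; last exact: continuous_plane_measurable.
rewrite -/d Ez big_map -(ler_pM2l dR).
have -> : d%:R * `|d%:R^-1 * (\sum_(u <- us) f (plane_of (joukowski m h u))) - c 0%N| =
   `|\sum_(u <- us) (f (plane_of (joukowski m h u)) - c 0%N)|.
  rewrite -{1}[d%:R]normr_nat -normrM mulrBr mulVKf ?gt_eqF//; congr `|_|.
  by rewrite sumrB big_const_seq count_predT iter_addr_0 sz mulr_natl.
have -> : \sum_(u <- us) (f (plane_of (joukowski m h u)) - c 0%N) =
  \sum_(u <- us) (f (plane_of (joukowski m h u)) - (c 0%N + \sum_(k < n) c k.+1 * complex.Re (u ^+ k.+1)))
  + \sum_(k < n) c k.+1 * \sum_(u <- us) complex.Re (u ^+ k.+1).
  under [X in _ + X]eq_bigr => k _ do rewrite mulr_sumr.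
  rewrite exchange_big /= -big_split /=; apply: eq_bigr => u _; ring.
apply: le_trans (ler_normD _ _) _.
have -> : d%:R * (2 * e + (C + \sum_(k < n) `|c k.+1| * k.+1%:R) * (discrepancy d B / d%:R)) =
  (d%:R * (2 * e) + C * discrepancy d B) + (\sum_(k < n) `|c k.+1| * k.+1%:R) * discrepancy d B.
  by field; rewrite gt_eqF.
apply: lerD.
  apply: le_trans (ler_norm_sum _ _ _) _.
  apply: (@le_trans _ _ (\sum_(u <- us) (2 * e - C * ln (cabs u)))).
    by rewrite !big_seq; apply: ler_sum => u uus; apply: H; [exact: us0|exact: us1].
  rewrite sumrB big_const_seq count_predT iter_addr_0 sz -(mulr_natl (2 * e) d) lerD2l -mulr_sumr -mulrN.
  by rewrite ler_wpM2l.
apply: le_trans (ler_norm_sum _ _ _) _; rewrite mulr_suml; apply: ler_sum => k _.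
by rewrite normrM -mulrA ler_wpM2l// dB.
Qed.

End TestFunctions.

(** * Weak convergence from a vanishing normalized discrepancy *)

Section WeakConvergence.
Context (R : realType) (m h : R).
Hypothesis h0 : 0 < h.

Lemma zero_counting_weak_cvg (q : nat -> {poly R[i]}) (B : nat -> R) :
  (\forall n \near \oo, [/\ q n != 0, (0 < (size (q n)).-1)%N &
     forall x, seg m h x -> cabs (q n).[x%:C] <= cabs (lead_coef (q n)) * B n]) ->
  discrepancy h (size (q n)).-1 (B n) / ((size (q n)).-1)%:R @[n --> \oo] --> (0 : R) ->
  weak_cvg (fun n => zero_counting (q n)) (equilibrium_measure (real_in_plane (seg m h))).
Proof.
move=> Hq Hd f cf sf.
apply/cvgrPdist_le => e e0.
(* One quarter goes to the equilibrium integral, two to the approximation at the zeros, one to the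
   discrepancy. *)
have e40 : 0 < e / 4 by rewrite divr_gt0.
have [n0 [c Hc]] := segment_approx m h0 cf e40.
have h1 := equilibrium_integral_approx h0 cf sf Hc.
have [C C0 HC] := disc_approx h0 cf sf e40 Hc.
pose K := C + \sum_(k < n0) `|c k.+1| * k.+1%:R.
have K0 : 0 <= K.
  by rewrite addr_ge0// sumr_ge0// => k _; rewrite mulr_ge0.
have K1 : 0 < K + 1 by rewrite ltr_wpDl.
have e4K : 0 < e / 4 / (K + 1) by rewrite divr_gt0.
have /cvgr0_norm_le /(_ _ e4K) Hd' := Hd.
near=> n.
have [q0 d0 qB] : [/\ q n != 0, (0 < (size (q n)).-1)%N &
     forall x, seg m h x -> cabs (q n).[x%:C] <= cabs (lead_coef (q n)) * B n] by near: n.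
have h2 := zero_average h0 cf q0 d0 qB C0 HC.
have h3 : `|discrepancy h (size (q n)).-1 (B n) / ((size (q n)).-1)%:R| <= e / 4 / (K + 1) by near: n.
rewrite -/K in h2.
move: h2 h3; set D := discrepancy _ _ _ / _ => h2 h3.
have h4 : K * D <= e / 4.
  apply: (@le_trans _ _ (K * (e / 4 / (K + 1)))).
    by rewrite ler_wpM2l// (le_trans (ler_norm _) h3).
  by rewrite mulrCA ler_piMr ?(ltW e40)// ler_pdivrMr// mul1r lerDl.
set I1 := \int[_]_z f z in h1 *; set I2 := \int[_]_z f z in h2 *.
have -> : I1 - I2 = (I1 - c 0%N) - (I2 - c 0%N) by ring.
by rewrite (le_trans (ler_normB _ _))//; lra.
Unshelve. all: by end_near. Qed.

End WeakConvergence.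

(** * Minimal polynomials *)

Section Support.
Context (R : realType) (mu : {measure set R -> \bar R}).

Lemma closed_msupport : closed (msupport mu).
Proof.
rewrite -openC openE => x /= nSx.
have [U [oU Ux U0]] : exists U : set R, [/\ open U, U x & ~ (0 < mu U)%E].
  apply: contrapT => H; apply: nSx => U oU Ux; apply: contrapT => U0.
  by apply: H; exists U.
rewrite /interior; apply: (filterS (P := U)); last exact: open_nbhs_nbhs.
by move=> y Uy Sy; apply: U0; exact: Sy.
Qed.

(** Every point off the support lies in an interval of measure 0 with rational endpoints, and there
    are countably many of these. *)
Lemma measure_msupportC : mu (~` msupport mu) = 0%E.
Proof.
have oS : open (~` msupport mu) by rewrite openC; exact: closed_msupport.
pose J (i : rat * rat) : set R := `]ratr i.1, ratr i.2[%classic.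
pose F (k : nat) : set R :=
  if unpickle k is Some i then if mu (J i) == 0%E then J i else set0 else set0.
have mF k : measurable (F k).
  by rewrite /F; case: unpickle => // i; case: ifP => // _; exact: measurable_itv.
have F0 k : mu (F k) = 0%E.
  by rewrite /F; case: unpickle => [i|]; [case: ifP => [/eqP//|_]|]; exact: measure0.
have sub : ~` msupport mu `<=` \bigcup_k F k.
  move=> x nSx.
  have [U [oU Ux U0]] : exists U : set R, [/\ open U, U x & ~ (0 < mu U)%E].
    apply: contrapT => H; apply: nSx => U oU Ux; apply: contrapT => U0.
    by apply: H; exists U.
  have /nbhs_ballP[e /= e0 eU] := open_nbhs_nbhs (conj oU Ux).
  have [q1] : exists q : rat, ratr q \in `]x - e, x[ by apply: rat_in_itvoo; rewrite ltrBlDr ltrDl.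
  have [q2] : exists q : rat, ratr q \in `]x, x + e[ by apply: rat_in_itvoo; rewrite ltrDl.
  rewrite !in_itv /= => /andP[a1 a2] /andP[b1 b2].
  exists (pickle (q1, q2)); first exact: I.
  rewrite /F pickleK.
  have JU : J (q1, q2) `<=` U.
    move=> y; rewrite /J /= in_itv /= => /andP[y1 y2]; apply: eU.
    rewrite -ball_normE /= ltr_norml; apply/andP.
    by move: a1 a2 b1 b2 y1 y2; set u := ratr q1; set v := ratr q2; split; lra.
  have -> : mu (J (q1, q2)) == 0%E.
    have mU : measurable U by exact: open_measurable.
    rewrite eq_le measure_ge0 andbT.
    apply: le_trans (_ : mu U <= _)%E; last by rewrite leNgt; apply/negP.
    by apply: le_measure; rewrite ?inE//; exact: measurable_itv.
  by rewrite /J /= in_itv /= b2 a1.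
have N : mu.-negligible (\bigcup_k F k).
  by apply: negligible_bigcup => k; exists (F k); split.
have /negligibleP : measurable (~` msupport mu) by exact: open_measurable.
by move=> /(_ _ mu) <-; exact: negligibleS N.
Qed.

(** The support is closed, so it contains its infimum and supremum; being its own hull it is the
    segment between them, and being infinite it is not a point. *)
Lemma hull_segment : infinite_set (msupport mu) -> hull mu = msupport mu ->
  bounded_set (hull mu) -> exists m h, 0 < h /\ hull mu = seg m h.
Proof.
move=> infS hS; rewrite hS => bS; set S := msupport mu in infS hS bS *.
have S0 : S !=set0 by apply/set0P/eqP => S0; apply: infS; rewrite S0.
have [M HM] : exists M, forall x, S x -> `|x| <= M.
  by case: bS => M0 [_ HM0]; exists (M0 + 1) => x; apply: HM0; rewrite ltrDl.
have ubS : has_ubound S by exists M => x /HM; rewrite ler_norml => /andP[].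
have lbS : has_lbound S by exists (- M) => x /HM; rewrite ler_norml => /andP[].
have cS : closed S by exact: closed_msupport.
have Sinf : S (inf S).
  apply: cS => V /nbhs_ballP[e /= e0 eV].
  have [y Sy yi] := inf_adherent e0 (conj S0 lbS).
  exists y; split => //; apply: eV; rewrite -ball_normE /= distrC ger0_norm; first by rewrite ltrBlDl.
  by rewrite subr_ge0; exact: ge_inf.
have Ssup : S (sup S).
  by apply: cS; exact: closure_sup.
have SE : S = [set x | inf S <= x <= sup S].
  apply/seteqP; split => x /=.
    by move=> Sx; rewrite (ge_inf lbS Sx) (ub_le_sup ubS Sx).
  move=> xab; have := @interval_is_interval R (Rhull S).
  move: (hS); rewrite /hull -/S => ->.
  by move=> /(_ _ _ Sinf Ssup x xab).
have ab : inf S < sup S.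
  rewrite ltNge; apply/negP => ba; apply: infS; rewrite SE.
  apply: (sub_finite_set (B := [set inf S])); last exact: finite_set1.
  by move=> x /= /andP[x1 x2]; apply/eqP; rewrite eq_le x1 (le_trans x2).
exists ((inf S + sup S) / 2), ((sup S - inf S) / 2); split.
  by rewrite divr_gt0// subr_gt0.
rewrite {1}SE; apply/seteqP; rewrite /seg; split => x /= /andP[x1 x2]; apply/andP; split; lra.
Qed.

End Support.

(** * Supremum, integral and Sobolev norms on the segment *)

Section Norms.
Context (R : realType) (m h : R).
Hypothesis h0 : 0 < h.
Implicit Types (q : {poly R[i]}) (x : R).
Let D := seg m h.

Lemma seg_center : D m.
Proof. by rewrite /D /seg /= lerBlDr lerDl (ltW h0). Qed.

Lemma horner_seg_bound q : exists M, forall x, D x -> cabs q.[x%:C] <= M.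
Proof.
exists (\sum_(i < size q) cabs q`_i * (`|m| + h) ^+ i) => x /andP[x1 x2].
rewrite horner_coef (le_trans (cabs_sum _ _ _))//; apply: ler_sum => i _.
rewrite cabsM cabsX ler_wpM2l ?cabs_ge0// lerXn2r ?nnegrE ?cabs_ge0//.
  by rewrite addr_ge0// ltW.
rewrite cabs_real ler_norml; have := ler_norm m; have := ler_norm (- m).
by rewrite normrN => a b; apply/andP; split; lra.
Qed.

Lemma sup_norm_ub q x : D x -> cabs q.[x%:C] <= sup_norm D q.
Proof.
move=> Dx; apply: ub_le_sup; last by exists x.
by have [M HM] := horner_seg_bound q; exists M => _ [y Dy <-]; exact: HM.
Qed.

Lemma sup_norm_le q (B : R) : (forall x, D x -> cabs q.[x%:C] <= B) -> sup_norm D q <= B.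
Proof.
move=> H; apply: ge_sup; first by exists (cabs q.[m%:C]); exists m => //; exact: seg_center.
by move=> _ [x Dx <-]; exact: H.
Qed.

Lemma measurable_cabs_horner q : measurable_fun setT (fun x : R => cabs q.[x%:C]).
Proof.
have mRe : measurable_fun setT (fun x : R => complex.Re q.[x%:C]) /\
           measurable_fun setT (fun x : R => complex.Im q.[x%:C]).
  elim/poly_ind: q => [|q c [IH1 IH2]].
    by under eq_fun do rewrite horner0; under [X in _ /\ measurable_fun _ X]eq_fun do rewrite horner0.
  have E x : (q * 'X + c%:P).[x%:C] =
     (complex.Re q.[x%:C] * x + complex.Re c) +i* (complex.Im q.[x%:C] * x + complex.Im c).
    rewrite !hornerE; case: (q.[x%:C]) => a b; case: (c) => a' b' /=.
    by simpc; congr (_ +i* _); ring.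
  under eq_fun do rewrite E /=; under [X in _ /\ measurable_fun _ X]eq_fun do rewrite E /=.
  by split; apply: measurable_funD => //; exact: measurable_funM.
under eq_fun do rewrite -[cabs _]ger0_norm ?cabs_ge0// -sqrtr_sqr cabs_sqr.
apply: (@measurableT_comp _ _ _ _ _ _ (@Num.sqrt R)).
  by apply: continuous_measurable_fun; exact: sqrt_continuous.
by apply: measurable_funD; apply: measurable_funX; have [] := mRe.
Qed.

Variables (p : R) (mu : {finite_measure set R -> \bar R}).
Hypothesis p1 : 1 <= p.
Let p0 : 0 < p. Proof. exact: lt_le_trans ltr01 p1. Qed.

Let mseg : measurable D.
Proof. by rewrite /D seg_itv; exact: measurable_itv. Qed.

Let mpow q : measurable_fun setT (fun x : R => cabs q.[x%:C] `^ p).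
Proof.
apply: (@measurableT_comp _ _ _ _ _ _ (@powR R ^~ p)); first exact: measurable_powR.
exact: measurable_cabs_horner.
Qed.

Lemma powR_integrable q : mu.-integrable D (EFin \o (fun x : R => cabs q.[x%:C] `^ p)).
Proof.
apply: measurable_bounded_integrable => //.
- by rewrite -ge0_fin_numE ?measure_ge0// fin_num_measure.
- exact: measurable_funTS.
have [M HM] := horner_seg_bound q; exists (M `^ p); split; first exact: num_real.
move=> B MB x Dx; apply: le_trans (ltW MB).
have -> : `|cabs q.[x%:C] `^ p| = cabs q.[x%:C] `^ p by rewrite ger0_norm// powR_ge0.
apply: ge0_ler_powR; rewrite ?nnegrE ?cabs_ge0 ?(ltW p0)//; last exact: HM.
exact: le_trans (cabs_ge0 _) (HM x Dx).
Qed.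

Variables (N : nat) (c : 'I_N -> R) (ms : 'I_N -> nat) (A : 'I_N -> nat -> R).
Hypothesis hA : forall (j : 'I_N) (k : nat), (k <= ms j)%N -> 0 <= A j k.
Hypothesis hull_D : hull mu = D.

Lemma p_norm_le_sobolev q : hull mu = msupport mu ->
  p_norm p mu q <= sobolev_norm p mu c ms A q.
Proof.
move=> hS; rewrite /p_norm /sobolev_norm.
have D0 : mu (~` D) = 0%E by rewrite -hull_D hS; exact: measure_msupportC.
have -> : \int[mu]_x cabs q.[x%:C] `^ p = \int[mu]_(x in hull mu) cabs q.[x%:C] `^ p.
  rewrite /Rintegral (@integral_conull _ _ _ mu D)// ?hull_D//.
  exact/measurable_EFinP.
have S0 : 0 <= \sum_(j < N) \sum_(k < (ms j).+1) A j k * cabs (q^`(k)).[(c j)%:C] `^ p.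
  apply: sumr_ge0 => j _; apply: sumr_ge0 => k _; apply: mulr_ge0; last exact: powR_ge0.
  by apply: hA; rewrite -ltnS.
have I0 : 0 <= \int[mu]_(x in hull mu) cabs q.[x%:C] `^ p.
  by apply: Rintegral_ge0 => x _; exact: powR_ge0.
by apply: ge0_ler_powR; rewrite ?nnegrE ?addr_ge0 ?invr_ge0 ?(ltW p0)// lerDl.
Qed.

(** The exponent exceeds the highest derivative order at each node by one, so the discrete part of
    the norm vanishes on all multiples. *)
Definition node_poly : {poly R[i]} := \prod_(j < N) ('X - ((c j)%:C)%:P) ^+ (ms j).+1.

Lemma node_poly_monic : node_poly \is monic.
Proof. by apply: monic_prod => j _; rewrite monic_exp// monicXsubC. Qed.

Lemma derivn_XsubC_exp_root (S : {poly R[i]}) (a : R[i]) n k : (k < n)%N ->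
  ((('X - a%:P) ^+ n * S)^`(k)).[a] = 0.
Proof.
move=> kn; suff [S' ->] : exists S', (('X - a%:P) ^+ n * S)^`(k) = ('X - a%:P) ^+ (n - k) * S'.
  by rewrite !hornerE subrr expr0n subn_eq0 leqNgt kn mul0r.
elim: k kn => [|k IH] kn; first by exists S; rewrite derivn0 subn0.
have [S' E] := IH (ltnW kn).
have [l El] : exists l, (n - k = l.+1)%N by exists (n - k.+1)%N; lia.
exists (l.+1%:R *: S' + ('X - a%:P) * S'^`()).
rewrite derivnS E subnS El /= derivM deriv_exp derivXsubC mul1r scaler_nat exprS.
by rewrite mulrDr mulrA [_ ^+ l * ('X - _)]mulrC mulrnAl mulrnAr.
Qed.

Lemma sobolev_node_le q (B : R) : 0 <= B -> (forall x, D x -> cabs (node_poly * q).[x%:C] <= B) ->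
  sobolev_norm p mu c ms A (node_poly * q) <= B * (fine (mu D)) `^ p^-1.
Proof.
move=> B0 HB; rewrite /sobolev_norm big1 ?addr0 => [|j _]; last first.
  apply: big1 => k _; rewrite /node_poly (bigD1 j)//= -mulrA derivn_XsubC_exp_root//.
  by rewrite cabs0 powR0 ?mulr0// gt_eqF.
rewrite hull_D.
have -> : B * (fine (mu D)) `^ p^-1 = (B `^ p * fine (mu D)) `^ p^-1.
  rewrite powRM ?powR_ge0// ?fine_ge0// -powRrM mulfV ?gt_eqF// powRr1//.
have finD : mu D \is a fin_num by exact: fin_num_measure.
have le1 : \int[mu]_(x in D) cabs (node_poly * q).[x%:C] `^ p <= B `^ p * fine (mu D).
  rewrite -lee_fin -EFin_Rintegral//; last exact: powR_integrable.
  apply: (@le_trans _ _ (\int[mu]_(x in D) (B `^ p)%:E)%E).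
    apply: ge0_le_integral => //.
    - by move=> x _; rewrite lee_fin powR_ge0.
    - by apply: measurable_funTS; exact/measurable_EFinP.
    - move=> x Dx; rewrite lee_fin; apply: ge0_ler_powR; rewrite ?nnegrE ?cabs_ge0 ?(ltW p0)//.
      exact: HB.
  by rewrite integral_cst// EFinM fineK.
apply: ge0_ler_powR; rewrite ?nnegrE ?invr_ge0 ?(ltW p0)//.
- by apply: Rintegral_ge0 => x _; exact: powR_ge0.
- by rewrite mulr_ge0 ?powR_ge0 ?fine_ge0.
Qed.

End Norms.

(** * Sublinear growth *)

Section Sublinear.
Context (R : realType).
Implicit Types (f g : nat -> R) (c : R).

(* The bound limsup a_n^(1/n) <= r is expressed as
   [sublinear (fun n => ln (a n) - n%:R * ln r)]. *)
Definition sublinear g := forall e, 0 < e -> \forall n \near \oo, g n <= e * n%:R.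

Lemma sublinearD f g : sublinear f -> sublinear g -> sublinear (fun n => f n + g n).
Proof.
move=> sf sg e e0; have e20 : 0 < e / 2 by rewrite divr_gt0.
near=> n; have : f n <= e / 2 * n%:R by near: n; exact: sf.
have : g n <= e / 2 * n%:R by near: n; exact: sg.
by lra.
Unshelve. all: by end_near. Qed.

Lemma sublinear_cst c : sublinear (fun=> c).
Proof.
move=> e e0; near=> n; rewrite mulrC -ler_pdivrMr//.
by near: n; exact: nbhs_infty_ger.
Unshelve. all: by end_near. Qed.

Lemma sublinear_le f g : (\forall n \near \oo, f n <= g n) -> sublinear g -> sublinear f.
Proof.
move=> fg sg e e0; near=> n; apply: (@le_trans _ _ (g n)); near: n => //.
exact: sg.
Unshelve. all: by end_near. Qed.

(** The inequality ln (a y) <= a y - 1 with a = e/4 and y = 2n + 1 leaves slope e/2 in n and a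
    constant. *)
Lemma sublinear_ln : sublinear (fun n => ln (n.*2.+1)%:R).
Proof.
move=> e e0; pose a := e / 4.
have a0 : 0 < a by rewrite divr_gt0.
have H (n : nat) : ln (n.*2.+1)%:R <= e / 2 * n%:R + (a - 1 - ln a).
  have y0 : 0 < (n.*2.+1)%:R :> R by rewrite ltr0n.
  have : ln (a * (n.*2.+1)%:R) <= a * (n.*2.+1)%:R - 1.
    have ay : 0 < a * (n.*2.+1)%:R by rewrite mulr_gt0.
    have := @le_ln1Dx R (a * (n.*2.+1)%:R - 1).
    have -> : 1 + (a * (n.*2.+1)%:R - 1) = a * (n.*2.+1)%:R by ring.
    by apply; lra.
  rewrite lnM ?posrE// -natr1 -mul2n natrM.
  by move: (ln a) (ln _) => u v; rewrite /a; lra.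
have e20 : 0 < e / 2 by rewrite divr_gt0.
near=> n; apply: le_trans (H n) _.
have : a - 1 - ln a <= e / 2 * n%:R by near: n; exact: sublinear_cst.
by lra.
Unshelve. all: by end_near. Qed.

(** Sublinearity is one-sided; the constant c controls g from below. *)
Lemma sublinear_cvg0 g c : (\forall n \near \oo, c <= g n) -> sublinear g ->
  g n / n%:R @[n --> \oo] --> (0 : R).
Proof.
move=> cg sg; apply/cvgr0Pnorm_le => e e0; near=> n.
have n0 : 0 < n%:R :> R by rewrite ltr0n; near: n; exact: nbhs_infty_gt.
rewrite normrM normfV [`|n%:R|]ger0_norm ?(ltW n0)// ler_pdivrMr// ler_norml.
apply/andP; split; last by near: n; exact: sg.
rewrite lerNl; apply: (@le_trans _ _ (- c)).
  by rewrite lerN2; near: n.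
by near: n; exact: sublinear_cst.
Unshelve. all: by end_near. Qed.

End Sublinear.

Section DerivedPolynomials.
Context (R : realType).

Lemma derivn_monic_lead (q : {poly R[i]}) n j : q \is monic -> size q = n.+1 ->
  (j <= n)%N -> size q^`(j) = (n - j).+1 /\ lead_coef q^`(j) = (n ^_ j)%:R.
Proof.
move=> q1 sq jn.
have cn : (q^`(j))`_(n - j) = (n ^_ j)%:R.
  rewrite coef_derivn subnKC//.
  by move/monicP: q1; rewrite lead_coefE sq /= => ->.
have n0 : (n ^_ j)%:R != 0 :> R[i] by rewrite pnatr_eq0 -lt0n ffact_gt0.
have sz : size q^`(j) = (n - j).+1.
  apply/eqP; rewrite eqn_leq; apply/andP; split.
    apply/leq_sizeP => i ni; rewrite coef_derivn nth_default ?mul0rn// sq.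
    by move: ni jn; lia.
  by rewrite ltnNge; apply/negP => /leq_sizeP/(_ _ (leqnn _)) /eqP; rewrite cn (negbTE n0).
by split=> //; rewrite lead_coefE sz.
Qed.

Lemma horner_cheb_le (m h x : R) k : 0 < h -> seg m h x ->
  cabs (map_poly (real_complex R) (cheb m h k)).[x%:C] <= 2 * (h / 2) ^+ k.
Proof.
move=> h0 /(joukowski_unit_surj h0)[w w1 [_ <-]].
rewrite horner_map cabs_real /= cheb_unit//.
have hk : 0 <= 2 * (h / 2) ^+ k by rewrite mulr_ge0// exprn_ge0// divr_ge0// ltW.
rewrite normrM [`|2 * _|]ger0_norm// ler_piMr// (le_trans (normr_Re _))//.
by rewrite cabsX w1 expr1n.
Qed.

End DerivedPolynomials.

(** * Asymptotics of minimal polynomials and their derivatives *)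

Section MinimalPolynomials.
Context (R : realType) (p m h : R) (mu : {finite_measure set R -> \bar R})
  (N : nat) (c : 'I_N -> R) (ms : 'I_N -> nat) (A : 'I_N -> nat -> R)
  (P : nat -> {poly R[i]}).
Hypothesis h0 : 0 < h.
Hypothesis p1 : 1 <= p.
Hypothesis hA : forall (j : 'I_N) (k : nat), (k <= ms j)%N -> 0 <= A j k.
Hypothesis hull_seg : hull mu = seg m h.
Hypothesis hull_supp : hull mu = msupport mu.
Hypothesis hReg : Reg p mu.
Hypothesis hP : forall n : nat, monic_minimal (sobolev_norm p mu c ms A) n (P n).
Let D := seg m h.
Let h20 : 0 < h / 2. Proof. by rewrite divr_gt0. Qed.

Let P_monic n : P n \is monic. Proof. by have [] := hP n. Qed.
Let size_P n : size (P n) = n.+1. Proof. by have [] := hP n. Qed.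

Lemma minimal_p_norm_le : exists2 K, 0 < K &
  \forall n \near \oo, p_norm p mu (P n) <= K * (h / 2) ^+ n.
Proof.
have [M HM] := horner_seg_bound m h0 (node_poly c ms).
have M0 : 0 <= M by apply: le_trans (HM m (seg_center m h0)); exact: cabs_ge0.
set L := (size (node_poly c ms)).-1.
(* Collects the bound of [node_poly], the factor 2 of the Chebyshev polynomial, the mass of the
   segment and the loss of L degrees. *)
pose K := M * 2 * (fine (mu D)) `^ p^-1 / (h / 2) ^+ L.
have K0 : 0 <= K.
  by rewrite divr_ge0 ?mulr_ge0 ?powR_ge0// exprn_ge0// ltW.
exists (K + 1); first by rewrite ltr_wpDl.
near=> n.
(* The inequality is strict because [cheb] is monic only from index 1 on. *)
have Ln : (L < n)%N by near: n; exact: nbhs_infty_gt.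
have nL : (0 < n - L)%N by rewrite subn_gt0.
pose T := map_poly (real_complex R) (cheb m h (n - L)).
have T1 : T \is monic by rewrite /T map_monic cheb_monic.
have sT : size T = (n - L).+1 by rewrite /T size_map_poly size_cheb.
have sQ : size (node_poly c ms * T) = n.+1.
  rewrite size_monicM ?monic_neq0// ?node_poly_monic// sT.
  have : (0 < size (node_poly c ms))%N by rewrite size_poly_gt0 monic_neq0// node_poly_monic.
  by rewrite /L in Ln *; lia.
have [_ _ Pmin] := hP n.
apply: le_trans (p_norm_le_sobolev p1 c hA hull_seg (P n) hull_supp) _ => //.
apply: le_trans (Pmin _ _ sQ) _; first by rewrite monicMl ?node_poly_monic.
have B0 : 0 <= M * (2 * (h / 2) ^+ (n - L)).
  by rewrite !mulr_ge0// exprn_ge0// ltW.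
apply: le_trans (sobolev_node_le h0 p1 _ hull_seg B0 _) _.
  move=> x Dx; rewrite hornerM cabsM ler_pM ?cabs_ge0//; first exact: HM.
  exact: horner_cheb_le.
apply: (@le_trans _ _ (K * (h / 2) ^+ n)); last first.
  by rewrite ler_wpM2r ?exprn_ge0 ?(ltW h20)// lerDl.
rewrite -[in leRHS](subnK (ltnW Ln)) exprD /K le_eqVlt; apply/orP; left; apply/eqP.
have b0 : (h / 2) ^+ L != 0 by rewrite gt_eqF// exprn_gt0.
rewrite -/D; move: ((h / 2) ^+ (n - L)) ((h / 2) ^+ L) (fine _ `^ _) b0 => a b w b0.
by rewrite -!mulrA [b^-1 * _]mulrCA mulVf// mulr1 [w * a]mulrC.
Unshelve. all: by end_near. Qed.

Lemma minimal_sup_ge j n : (j <= n)%N ->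
  cabs (lead_coef (P n)^`(j)) * (h / 2) ^+ (n - j) <= sup_norm D (P n)^`(j).
Proof.
move=> jn; have [sz lc] := derivn_monic_lead (P_monic n) (size_P n) jn.
have l0 : lead_coef (P n)^`(j) != 0 by rewrite lc pnatr_eq0 -lt0n ffact_gt0.
have lp : 0 < cabs (lead_coef (P n)^`(j)) by rewrite cabs_gt0.
pose q := (lead_coef (P n)^`(j))^-1 *: (P n)^`(j).
have q1 : q \is monic by rewrite monicE lead_coefZ mulVf.
have qB x : m - h <= x <= m + h ->
    cabs q.[x%:C] <= sup_norm D (P n)^`(j) / cabs (lead_coef (P n)^`(j)).
  move=> xs; rewrite hornerZ cabsM cabsV mulrC ler_wpM2r ?invr_ge0 ?cabs_ge0//.
  exact: sup_norm_ub.
have := ge_capacity h0 q1 qB; rewrite size_scale ?invr_eq0// sz /=.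
by rewrite ler_pdivlMr// mulrC.
Qed.

Lemma cabs_lead_ge1 j n : (j <= n)%N -> 1 <= cabs (lead_coef (P n)^`(j)).
Proof.
move=> jn; have [_ ->] := derivn_monic_lead (P_monic n) (size_P n) jn.
by rewrite cabs_nat ler1n ffact_gt0.
Qed.

Lemma minimal_sup_ge_pow j n : (j <= n)%N -> (h / 2) ^+ (n - j) <= sup_norm D (P n)^`(j).
Proof.
move=> jn; apply: le_trans (minimal_sup_ge jn).
by rewrite ler_peMl ?exprn_ge0 ?(ltW h20)// cabs_lead_ge1.
Qed.

Lemma minimal_sup_gt0 j n : (j <= n)%N -> 0 < sup_norm D (P n)^`(j).
Proof. by move=> /minimal_sup_ge_pow; apply: lt_le_trans; exact: exprn_gt0. Qed.

(** For large n, regularity bounds the supremum norm by exp(e n / 2) times the p-norm, which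
    [minimal_p_norm_le] controls. *)
Lemma minimal_sup_sublinear :
  sublinear (fun n => ln (sup_norm D (P n)) - n%:R * ln (h / 2)).
Proof.
have [K K0 HK] := minimal_p_norm_le.
move=> e e0; have e20 : 0 < e / 2 by rewrite divr_gt0.
have := hReg _ (fun n => monic_neq0 (P_monic n)).
rewrite hull_seg -/D => /(_ (fun n => eq_leq (size_P n))) cR.
near=> n.
have n0 : 0 < n%:R :> R by rewrite ltr0n; near: n; exact: nbhs_infty_gt.
have hK : p_norm p mu (P n) <= K * (h / 2) ^+ n by near: n.
(* Excludes a zero p-norm, for which the quotient would be 0 by convention. *)
have r_gt : 2^-1 < (sup_norm D (P n) / p_norm p mu (P n)) `^ n%:R^-1.
  by near: n; apply: (cvgr_gt _ cR); lra.
have r_lt : (sup_norm D (P n) / p_norm p mu (P n)) `^ n%:R^-1 < expR (e / 2).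
  by near: n; apply: (cvgr_lt _ cR); rewrite expR_gt1.
move: r_gt r_lt hK; set s := sup_norm D (P n); set q := p_norm p mu (P n).
move=> r_gt r_lt hK.
have q0 : 0 <= q by exact: powR_ge0.
have s0 : 0 < s by apply: (@minimal_sup_gt0 0).
have sq0 : 0 < s / q.
  have [sq|] := ltP 0 (s / q) => // sq.
  have sqE : s / q = 0 by apply/eqP; rewrite eq_le sq divr_ge0// ltW.
  by move: r_gt; rewrite sqE powR0 ?invr_eq0 ?gt_eqF//; lra.
have q_gt0 : 0 < q.
  by move: sq0; rewrite pmulr_rgt0// invr_gt0.
have l1 : ln (s / q) <= e / 2 * n%:R.
  have : ln ((s / q) `^ n%:R^-1) <= ln (expR (e / 2)).
    by rewrite ler_ln ?posrE ?expR_gt0 ?powR_gt0// ltW.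
  by rewrite ln_powR expRK mulrC ler_pdivrMr.
have l2 : ln q <= ln K + n%:R * ln (h / 2).
  rewrite mulr_natl -lnXn// -lnM ?posrE ?exprn_gt0// ler_ln ?posrE ?mulr_gt0 ?exprn_gt0//.
have l3 : ln K <= e / 2 * n%:R by near: n; exact: sublinear_cst.
have : ln s = ln (s / q) + ln q by rewrite -lnM ?posrE// divfK// gt_eqF.
by lra.
Unshelve. all: by end_near. Qed.

(** The Markov inequality with kappa = e/4. Four terms contribute e/4 each: the constant j!/delta^j,
    the factor 2n + 1, the power (1 + kappa)^n and the norm of [P n]. *)
Lemma derived_sup_sublinear j :
  sublinear (fun n => ln (sup_norm D (P n)^`(j)) - n%:R * ln (h / 2)).
Proof.
move=> e e0; have e40 : 0 < e / 4 by rewrite divr_gt0.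
have [delta d0 Hd] := monic_markov m h0 e40.
pose K := ln (j`!%:R / delta ^+ j).
have j0 : 0 < j`!%:R / delta ^+ j by rewrite divr_gt0 ?exprn_gt0// ltr0n fact_gt0.
have k1 : 0 < 1 + e / 4 by rewrite addr_gt0.
near=> n.
have jn : (j <= n)%N by near: n; exact: nbhs_infty_ge.
have s0 : 0 < sup_norm D (P n) by apply: (@minimal_sup_gt0 0).
have t0 := minimal_sup_gt0 jn.
have up : sup_norm D (P n)^`(j) <=
    j`!%:R / delta ^+ j * ((n.*2.+1)%:R * (1 + e / 4) ^+ n * sup_norm D (P n)).
  apply: sup_norm_le => // x xs.
  have := Hd _ _ (P_monic n) (fun x => @sup_norm_ub _ _ _ h0 (P n) x) j x xs.
  rewrite size_P /= => H.
  have -> : cabs (P n)^`(j).[x%:C] = j`!%:R * cabs (P n)^`N(j).[x%:C].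
    by rewrite nderivn_def hornerMn -(mulr_natl (horner _ _)) cabsM cabs_nat.
  have dj : delta ^+ j != 0 by rewrite gt_eqF// exprn_gt0.
  by rewrite -[X in X * _ <= _](mulfVK dj (j`!%:R)) -[X in X <= _]mulrA ler_wpM2l// ltW.
have n20 : 0 < (n.*2.+1)%:R :> R by rewrite ltr0n.
have lnup : ln (sup_norm D (P n)^`(j)) <=
    K + (ln (n.*2.+1)%:R + n%:R * ln (1 + e / 4) + ln (sup_norm D (P n))).
  have kn : 0 < (1 + e / 4) ^+ n by rewrite exprn_gt0.
  have y0 : 0 < (n.*2.+1)%:R * (1 + e / 4) ^+ n by exact: mulr_gt0.
  have z0 : 0 < (n.*2.+1)%:R * (1 + e / 4) ^+ n * sup_norm D (P n) by exact: mulr_gt0.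
  rewrite mulr_natl -lnXn// /K -lnM ?posrE// -lnM ?posrE// -lnM ?posrE//.
  by rewrite ler_ln ?posrE//; exact: mulr_gt0.
have l1 : ln (1 + e / 4) <= e / 4 by apply: le_ln1Dx; lra.
have l1' : n%:R * ln (1 + e / 4) <= n%:R * (e / 4) by rewrite ler_wpM2l.
have l2 : K <= e / 4 * n%:R by near: n; exact: sublinear_cst.
have l3 : ln (n.*2.+1)%:R <= e / 4 * n%:R by near: n; exact: sublinear_ln.
have l4 : ln (sup_norm D (P n)) - n%:R * ln (h / 2) <= e / 4 * n%:R.
  by near: n; exact: minimal_sup_sublinear.
by lra.
Unshelve. all: by end_near. Qed.

Let derived_ge j n : (j <= n)%N ->
  - (j%:R * ln (h / 2)) <= ln (sup_norm D (P n)^`(j)) - n%:R * ln (h / 2).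
Proof.
move=> jn; have : ln ((h / 2) ^+ (n - j)) <= ln (sup_norm D (P n)^`(j)).
  by rewrite ler_ln ?posrE ?exprn_gt0 ?minimal_sup_gt0 ?minimal_sup_ge_pow.
by rewrite lnXn// -[_ *+ _]mulr_natl natrB//; lra.
Qed.

(** The capacity bound below and [derived_sup_sublinear] above make (ln of the norm)/n tend to ln
    (h/2); the exponential is continuous. *)
Lemma derived_sup_root_cvg j :
  sup_norm D (P n)^`(j) `^ n%:R^-1 @[n --> \oo] --> h / 2.
Proof.
have c0 : (ln (sup_norm D (P n)^`(j)) - n%:R * ln (h / 2)) / n%:R @[n --> \oo] --> (0 : R).
  apply: (@sublinear_cvg0 _ _ (- (j%:R * ln (h / 2)))); last exact: derived_sup_sublinear.
  by near=> n; apply: derived_ge; near: n; exact: nbhs_infty_ge.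
have c1 : (ln (sup_norm D (P n)^`(j)) - n%:R * ln (h / 2)) / n%:R + ln (h / 2)
    @[n --> \oo] --> ln (h / 2).
  rewrite -[X in _ --> X]add0r; apply: cvgD; [exact: c0|exact: cvg_cst].
have c2 := cvg_comp _ _ c1 (@continuous_expR R (ln (h / 2))).
rewrite lnK ?posrE// in c2.
apply: cvg_trans c2; apply: near_eq_cvg; near=> n.
have n0 : 0 < n%:R :> R by rewrite ltr0n; near: n; exact: nbhs_infty_gt.
have t0 : 0 < sup_norm D (P n)^`(j).
  by apply: minimal_sup_gt0; near: n; exact: nbhs_infty_ge.
rewrite /= /powR gt_eqF//; congr expR.
by field; rewrite gt_eqF.
Unshelve. all: by end_near. Qed.

(** The discrepancy is nonnegative by [minimal_sup_ge]. It is sublinear because the leading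
    coefficient is at least 1 and the lower degree n - j only adds the constant j ln (h/2). *)
Lemma derived_discrepancy_cvg0 j :
  discrepancy h (size (P n)^`(j)).-1 (sup_norm D (P n)^`(j) / cabs (lead_coef (P n)^`(j)))
    / ((size (P n)^`(j)).-1)%:R @[n --> \oo] --> (0 : R).
Proof.
pose g n := discrepancy h (n - j) (sup_norm D (P n)^`(j) / cabs (lead_coef (P n)^`(j))).
have sg : sublinear g.
  apply: (@sublinear_le _ _ (fun n => ln (n.*2.+1)%:R +
     ((ln (sup_norm D (P n)^`(j)) - n%:R * ln (h / 2)) + j%:R * ln (h / 2)))); last first.
    apply: sublinearD; first exact: sublinear_ln.
    by apply: sublinearD; [exact: derived_sup_sublinear|exact: sublinear_cst].
  near=> n; have jn : (j <= n)%N by near: n; exact: nbhs_infty_ge.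
  have t0 := minimal_sup_gt0 jn.
  have l1 := cabs_lead_ge1 jn.
  have l0 : 0 < cabs (lead_coef (P n)^`(j)) by apply: lt_le_trans l1.
  have hj : 0 < (h / 2) ^+ (n - j) by rewrite exprn_gt0.
  have y0 : 0 < ((n - j).*2.+1)%:R :> R by rewrite ltr0n.
  rewrite /g /discrepancy lnM ?posrE ?divr_gt0// lerD//.
    by rewrite ler_ln ?posrE ?ltr0n// ler_nat; lia.
  rewrite ln_div ?posrE ?divr_gt0// ln_div ?posrE// lnXn// -[_ *+ (n - j)]mulr_natl natrB//.
  have := ln_ge0 l1; rewrite mulrBl.
  move: (ln (cabs _)) (ln (sup_norm _ _)) (_ * ln _) (_ * ln _) => a b u v a0.
  by rewrite opprB [u - v]addrC addrA lerD2r lerD2r gerBl.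
have g0 : \forall n \near \oo, 0 <= g n.
  near=> n; have jn : (j <= n)%N by near: n; exact: nbhs_infty_ge.
  have l1 := cabs_lead_ge1 jn.
  have l0 : 0 < cabs (lead_coef (P n)^`(j)) by apply: lt_le_trans l1.
  have hj : 0 < (h / 2) ^+ (n - j) by rewrite exprn_gt0.
  apply: ln_ge0; rewrite -[leLHS]mulr1 ler_pM ?ler1n// .
  by rewrite ler_pdivlMr// mul1r ler_pdivlMr// mulrC minimal_sup_ge.
have c0 := sublinear_cvg0 g0 sg.
apply/cvgr0Pnorm_le => e e0.
have e20 : 0 < e / 2 by rewrite divr_gt0.
have /cvgr0_norm_le /(_ _ e20) H := c0.
(* For n > 2j one has n <= 2 (n - j), so dividing by n - j instead of n costs at most a factor 2. *)
near=> n; have jn : (j.*2 < n)%N by near: n; exact: nbhs_infty_gt.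
have jn' : (j <= n)%N by rewrite -addnn in jn; lia.
have n0 : 0 < n%:R :> R by rewrite ltr0n; lia.
have nj0 : 0 < (n - j)%:R :> R by rewrite ltr0n; lia.
have [sz _] := derivn_monic_lead (P_monic n) (size_P n) jn'.
rewrite sz /= -/(g n).
have Hn : `|g n / n%:R| <= e / 2 by near: n.
have gn : 0 <= g n by near: n.
rewrite ger0_norm ?divr_ge0 ?ler0n// ler_pdivrMr//.
rewrite ger0_norm ?divr_ge0 ?ler0n// ler_pdivrMr// in Hn.
apply: le_trans Hn _; rewrite -mulrA ler_wpM2l ?(ltW e0)//.
rewrite ler_pdivrMl// -natrM ler_nat; lia.
Unshelve. all: by end_near. Qed.

Lemma derived_zeros_weak_cvg j :
  weak_cvg (fun n => zero_counting (P n)^`(j)) (equilibrium_measure (real_in_plane D)).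
Proof.
apply: (zero_counting_weak_cvg h0 _ (derived_discrepancy_cvg0 j)).
near=> n; have jn : (j < n)%N by near: n; exact: nbhs_infty_gt.
have [sz lc] := derivn_monic_lead (P_monic n) (size_P n) (ltnW jn).
have l1 := cabs_lead_ge1 (ltnW jn).
have l0 : 0 < cabs (lead_coef (P n)^`(j)) by apply: lt_le_trans l1.
split.
- by rewrite -size_poly_gt0 sz.
- by rewrite sz /= subn_gt0.
- by move=> x xs; rewrite mulrCA mulfV ?gt_eqF// mulr1; exact: sup_norm_ub.
Unshelve. all: by end_near. Qed.

End MinimalPolynomials.

Unset Implicit Arguments.

Theorem theorem3p2 (R : realType) (p : R)
  (mu : {finite_measure set R -> \bar R})
  (N : nat) (c : 'I_N -> R) (m : 'I_N -> nat) (A : 'I_N -> nat -> R)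
  (P : nat -> {poly R[i]})
  (hp : 1 <= p)
  (hsupp : infinite_set (msupport mu))
  (hL1 : forall q : {poly R[i]},
     mu.-integrable setT (fun x : R => (cabs q.[x%:C])%:E))
  (hc : injective c)
  (hA : forall (j : 'I_N) (k : nat), (k <= m j)%N -> 0 <= A j k)
  (hAm : forall j : 'I_N, 0 < A j (m j))
  (hDelta : hull mu = msupport mu)
  (hbounded : bounded_set (hull mu))
  (hReg : Reg p mu)
  (hP : forall n : nat, monic_minimal (sobolev_norm p mu c m A) n (P n)) :
  forall j : nat,
    sup_norm (hull mu) (P n)^`(j) `^ n%:R^-1 @[n --> \oo]
      --> cap (real_in_plane (hull mu))
    /\ weak_cvg (fun n => zero_counting (P n)^`(j))
         (equilibrium_measure (real_in_plane (hull mu))).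
Proof.
move=> j; have [m0 [h [h0 hE]]] := hull_segment hsupp hDelta hbounded.
rewrite hE cap_seg//; split.
  exact: (derived_sup_root_cvg h0 hp hA hE hDelta hReg hP).
exact: (derived_zeros_weak_cvg h0 hp hA hE hDelta hReg hP).
Qed.
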